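(* There exist absolute constants $c,c'>0$ such that for all integers $k\ge2$ and $1\le\Delta\le ck$, $$n^*(k,\Delta)\ge c'\,\frac{k}{\log k}\log\frac k\Delta.$$ The same lower bound holds for the analogous sample complexity under sampling without replacement.
   Context: For an urn of $k$ colored balls let $C$ be its number of distinct colors. The sample complexity $n^*(k,\Delta)$ is the minimal integer $n$ such that there exists an integer-valued estimator $\hat C$ based on $n$ balls drawn independently and uniformly with replacement from the urn such that $\mathbb{P}[|\hat C-C|\ge\Delta]\le0.1$ for every urn containing $k$ balls. The without-replacement analog is defined identically except that the $n$ balls are drawn uniformly at random without replacement. Logarithms are natural. *)

(* Defs.v *)
From mathcomp Require Import all_boot all_order all_algebra.
From Stdlib Require Import Reals.

Set Implicit Arguments.
Unset Strict Implicit.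
Unset Printing Implicit Defensive.

(* An urn of k balls: ball i has color (u i); colors are natural numbers
   (an arbitrary countable palette, at most k colors are used). *)
Definition urn (k : nat) := 'I_k -> nat.

Definition num_colors (k : nat) (u : urn k) : nat :=
  size (undup [seq u i | i <- enum 'I_k]).

(* An integer-valued estimator based on the observed (ordered) sequence
   of colors of the drawn balls. *)
Definition estimator := seq nat -> int.

Definition errs (k n Delta : nat) (est : estimator) (u : urn k)
    (t : n.-tuple 'I_k) : bool :=
  (Delta <= absz (GRing.add (est [seq u i | i <- t]) (GRing.opp (Posz (num_colors u)))))%N.

(* With replacement: the draw t is uniform among all k^n tuples of indices.
   P[|est - C| >= Delta] <= 0.1  <=>  10 * #bad <= k^n. *)
Definition feasible_wr (k Delta n : nat) : Prop :=
  exists est : estimator, forall u : urn k,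
    (10 * #|[set t : n.-tuple 'I_k | errs Delta est u t]| <= k ^ n)%N.

(* Without replacement: the draw t is uniform among tuples of pairwise
   distinct indices (ordered sample of n distinct balls). *)
Definition feasible_wor (k Delta n : nat) : Prop :=
  exists est : estimator, forall u : urn k,
    (10 * #|[set t : n.-tuple 'I_k | uniq t && errs Delta est u t]|
       <= #|[set t : n.-tuple 'I_k | uniq t]|)%N.

(* Main.v *)
Require Import Defs.
From mathcomp Require Import all_boot all_order all_algebra.
From mathcomp Require Import ring lra zify.

(** Two random urns that a sample of [n] balls cannot tell apart.  Each of [M]
    colors independently gets a random multiplicity [N], the remaining balls
    share one filler color, and the balls are shuffled.  The law of [N] is
    [P + A] in the first urn and [P - A] in the second, where the signed measure
    [A] annihilates all polynomials in [N] of degree less than [L] but charges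
    [N = 0]: the expected numbers of colors differ by [2 M A(N = 0)].

    Changing the law of a single multiplicity, with all the others fixed, changes
    the law of the observation by a sum over the sets [I] of sampled balls, with
    a term of size at most [2 ^ |I|] times the [|I|]-th factorial moment of [A]
    over ['C(K, |I|)], [K] being the number of balls left for this color and the
    filler.  Moments below [L] vanish, so this is at most [2 / 2 ^ L] as soon as
    [n m / k] is small compared with [L], where [m] bounds [N].

    The measure [A] is a [T]-th convolution power of the divided difference at
    the nodes [0, 1, 2] and [8 i ^ 2], [1 <= i <= d]: there [m = 8 d ^ 2], [L > d],
    the mass at [0] is at least [1 / 8] and the mean is bounded.  The power has
    [m = 8 d ^ 2 T], [L > d T] and mass [8 ^ - T] at [0].  Taking [T] of order
    [log (k / Delta)] and [d T] of order [log k], the two urns are separated by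
    [Delta] yet indistinguishable unless [n] exceeds a multiple of [k / d]. *)

Set Implicit Arguments.
Unset Strict Implicit.
Unset Printing Implicit Defensive.

Import Order.TTheory GRing.Theory Num.Theory.
Local Open Scope ring_scope.

(** * Divided differences annihilate polynomials of low degree *)

Section DividedDifferences.

Variables (F : fieldType) (n : nat) (x : 'I_n -> F).
Hypothesis x_inj : injective x.

Lemma size_prod_nodes_but (t : 'I_n) :
  size (\prod_(s < n | s != t) ('X - (x s)%:P)) = n.
Proof.
rewrite size_prod => [|i _]; last by rewrite polyXsubC_eq0.
under eq_bigr do rewrite size_XsubC.
rewrite sum_nat_const; have := cardC1 t; rewrite card_ord => E.
have -> : #|[pred i | i != t]| = n.-1 by rewrite -E; apply: eq_card.
have n0 : (0 < n)%N by apply: leq_ltn_trans (ltn_ord t).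
lia.
Qed.

(** The sum is the coefficient of ['X^(n.-1)] in the Lagrange interpolant [q] of [p] at the nodes.
    Both have size at most [n] and agree at [n] points, so [q = p], whose coefficient there is
    zero. *)
Lemma sum_divided_difference (p : {poly F}) : (size p < n)%N ->
  \sum_(t < n) p.[x t] * (\prod_(s < n | s != t) (x t - x s))^-1 = 0.
Proof.
move=> sp.
pose w t : F := (\prod_(s < n | s != t) (x t - x s))^-1.
have wN0 t : \prod_(s < n | s != t) (x t - x s) != 0.
  by apply/prodf_neq0 => s st; rewrite subr_eq0 inj_eq // eq_sym.
pose q : {poly F} := \sum_(t < n) (p.[x t] * w t) *: \prod_(s < n | s != t) ('X - (x s)%:P).
have qx u : q.[x u] = p.[x u].
  rewrite horner_sum (bigD1 u) //= [X in _ + X]big1 ?addr0 => [|t tu].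
    rewrite hornerZ horner_prod; under eq_bigr do rewrite hornerXsubC.
    by rewrite mulfVK.
  by rewrite hornerZ horner_prod (bigD1 u) 1?eq_sym //= hornerXsubC subrr mul0r mulr0.
have sq : (size q <= n)%N.
  apply: leq_trans (size_sum _ _ _) _; apply/bigmax_leqP => t _.
  by apply: leq_trans (size_scale_leq _ _) _; rewrite size_prod_nodes_but.
have pq : q = p.
  apply/eqP; rewrite -subr_eq0; apply/negPn/negP => qp0.
  have := @max_poly_roots _ _ [seq x t | t <- enum 'I_n] qp0.
  rewrite size_map size_enum_ord map_inj_uniq ?enum_uniq // => /(_ _ isT) H.
  have : (n < size (q - p)%R)%N.
    apply: H; apply/allP => _ /mapP[u _ ->].
    by rewrite /root hornerD hornerN qx subrr.
  rewrite ltnNge => /negP; apply.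
  apply: leq_trans (size_polyD _ _) _; rewrite size_polyN geq_max sq.
  exact: ltnW.
have n0 : (0 < n)%N by apply: leq_trans sp.
have : q`_n.-1 = 0 by rewrite pq nth_default // -ltnS prednK.
rewrite coef_sum => E; rewrite -[RHS]E; apply: eq_bigr => t _.
rewrite coefZ; pose P := \prod_(s < n | s != t) ('X - (x s)%:P).
have : lead_coef P = 1 by rewrite /P lead_coef_prod big1 // => s _; rewrite lead_coefXsubC.
by rewrite lead_coefE /P size_prod_nodes_but => ->; rewrite mulr1.
Qed.

End DividedDifferences.

(** * Pairs of laws with matching moments, and their convolution powers *)

Section Kernels.

Variable F : realFieldType.

(* [P + A] and [P - A] are two laws for the multiplicity [N] of a color that
   have the same factorial moments of order less than [L]. *)
Record kernel (m L : nat) (mu g : F) (O : finType) (P A : O -> F)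
    (N : O -> nat) : Prop := Kernel {
  kernel_abs : forall w, `|A w| <= P w;
  kernel_mass : \sum_w P w = 1;
  kernel_max : forall w, (N w <= m)%N;
  kernel_cancel : forall i, (i < L)%N -> \sum_w A w * 'C(N w, i)%:R = 0;
  kernel_mean : \sum_w P w * (N w)%:R <= mu;
  kernel_zero : g <= \sum_(w | N w == 0%N) A w }.

(** This is the convolution step. By Vandermonde, the [i]-th binomial moment of the sum is a sum of
    products of moments of orders [j] and [i - j]; if [i < L1 + L2], one of the two orders is below
    its threshold. *)
Lemma kernel_prod m1 m2 L1 L2 (mu1 mu2 g1 g2 : F) (O1 O2 : finType)
    (P1 A1 : O1 -> F) N1 (P2 A2 : O2 -> F) N2 : 0 <= g1 -> 0 <= g2 ->
  kernel m1 L1 mu1 g1 P1 A1 N1 -> kernel m2 L2 mu2 g2 P2 A2 N2 ->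
  kernel (m1 + m2) (L1 + L2) (mu1 + mu2) (g1 * g2)
    (fun w : O1 * O2 => P1 w.1 * P2 w.2) (fun w => A1 w.1 * A2 w.2)
    (fun w => N1 w.1 + N2 w.2)%N.
Proof.
move=> g1_ge0 g2_ge0 [abs1 mass1 max1 can1 mean1 zero1] [abs2 mass2 max2 can2 mean2 zero2].
have sum2 (f1 : O1 -> F) (f2 : O2 -> F) :
    \sum_(w : O1 * O2) f1 w.1 * f2 w.2 = (\sum_w f1 w) * \sum_w f2 w.
  rewrite big_distrl /= -(pair_bigA _ (fun u v => f1 u * f2 v)) /=.
  by apply: eq_bigr => u _; rewrite mulr_sumr.
split=> [w||w|i iL||].
- by rewrite normrM; apply: ler_pM.
- by rewrite sum2 mass1 mass2 mulr1.
- exact: leq_add.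
- under eq_bigr do rewrite -binomial.Vandermonde natr_sum mulr_sumr.
  rewrite exchange_big big1 //= => -[j /= ji] _.
  under eq_bigr do rewrite natrM mulrACA.
  rewrite (sum2 (fun w => A1 w * 'C(N1 w, j)%:R) (fun w => A2 w * 'C(N2 w, i - j)%:R)).
  have [jL|jL] := ltnP j L1; first by rewrite can1 // mul0r.
  by rewrite can2 ?mulr0 //; lia.
- under eq_bigr => w _ do
    rewrite natrD mulrDr [X in X + _]mulrAC -[X in _ + X]mulrA.
  rewrite big_split /= (sum2 (fun w => P1 w * (N1 w)%:R)).
  by rewrite (sum2 _ (fun w => P2 w * (N2 w)%:R)) mass1 mass2 mulr1 mul1r lerD.
- have -> : \sum_(w : O1 * O2 | (N1 w.1 + N2 w.2 == 0)%N) A1 w.1 * A2 w.2 =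
      (\sum_(w | N1 w == 0%N) A1 w) * \sum_(w | N2 w == 0%N) A2 w.
    rewrite !(big_mkcond (fun _ => _ == _)) /= -sum2; apply: eq_bigr => w _.
    by rewrite addn_eq0; case: eqP; case: eqP; rewrite ?mul0r ?mulr0.
  exact: ler_pM.
Qed.

Lemma kernel_unit :
  kernel 0 0 0 1 (fun _ : unit => 1 : F) (fun _ => 1) (fun _ => 0%N).
Proof.
split=> //; rewrite ?normr1 ?big_const ?card_unit /= ?mulr0 ?addr0 //.
Qed.

Lemma kernel_pow m L mu (g : F) (O : finType) (P A : O -> F) N T : 0 <= g ->
  kernel m L mu g P A N ->
  exists (O' : finType) (P' A' : O' -> F) (N' : O' -> nat),
    kernel (T * m) (T * L) (T%:R * mu) (g ^+ T) P' A' N'.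
Proof.
move=> g0 K; elim: T => [|T [O' [P' [A' [N' K']]]]].
  by exists unit, (fun=> 1), (fun=> 1), (fun=> 0%N); rewrite mul0r expr0; apply: kernel_unit.
have := kernel_prod g0 (exprn_ge0 T g0) K K'.
have -> : mu + T%:R * mu = T.+1%:R * mu by rewrite -natr1; ring.
rewrite -exprS -!mulSn => K2.
by do 4!eexists; apply: K2.
Qed.

End Kernels.

(** * The base kernel on the nodes 0, 1, 2 and 8 i^2 *)

Section BaseKernel.

Variable F : realFieldType.

(** Quadratic growth, as for Chebyshev nodes near an end point, keeps the weight at [0] comparable
    to the total weight. The extra nodes [1] and [2] make the weights at [8 i ^ 2] decay like
    [i ^ -4], so that the mean stays bounded. *)
Definition node (j : nat) : nat := if (j <= 2)%N then j else (8 * (j - 2) ^ 2)%N.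

Lemma node_tail i : (0 < i)%N -> node (i + 2) = (8 * i ^ 2)%N.
Proof. by move=> i0; rewrite /node ifF ?addnK //; lia. Qed.

Lemma node_inj : injective node.
Proof.
rewrite /node => a b; case: ifP => ha; case: ifP => hb //; nia.
Qed.

Lemma node_le d j : (0 < d)%N -> (j < d.+3)%N -> (node j <= 8 * d ^ 2)%N.
Proof.
move=> d0 jd; rewrite /node; case: ifP => h; first by nia.
by rewrite leq_mul2l leq_exp2r //; lia.
Qed.

Lemma ffact_polyE (t i : nat) :
  (\prod_(j < i) ('X - (j%:R)%:P)).[t%:R] = (t ^_ i)%:R :> F.
Proof.
rewrite horner_prod; elim: i => [|i IH]; first by rewrite big_ord0.
rewrite big_ord_recr /= IH hornerXsubC ffactnSr natrM.
have [it|ti] := leqP i t; first by rewrite natrB.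
by rewrite ffact_small // !mul0r.
Qed.

(* With [i = l] this is [(2i - 1)! = i * \prod_(1 <= j < i) (i ^ 2 - j ^ 2)]. *)
Lemma prod_sqr_diff_below i l : (0 < l <= i)%N ->
  (\prod_(1 <= j < l) (i ^ 2 - j ^ 2) * (i - l)`! * i = (i + l).-1`!)%N.
Proof.
elim: l => // -[|l] IH /andP[_ li].
  rewrite big_geq // mul1n addn1 /=.
  by case: i li {IH} => // i _; rewrite subn1 /= mulnC -factS.
rewrite big_nat_recr //= -[X in _ = X`!]/((i + l.+2).-1).
have -> : (i + l.+2).-1 = (i + l.+1).-1.+1 by lia.
rewrite factS -IH; last by lia.
have -> : (i - l.+1 = (i - l.+2).+1)%N by lia.
rewrite factS; have -> : (i ^ 2 - l.+1 ^ 2 = (i - l.+2).+1 * (i + l.+1).-1.+1)%N.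
  by rewrite subn_sqr; congr (_ * _)%N; lia.
by ring.
Qed.

(** The value [1] at [j = i] leaves the vanishing factor out of products. *)
Let sqd (i j : nat) : F := if j == i then 1 else `|(i ^ 2)%:R - (j ^ 2)%:R|.

(** The factors with [j < i] multiply to [(2i - 1)! / i]; those with [j > i], split as
    [(j - i) * (j + i)], multiply to [e! (e + 2i)! / (2i)!]. *)
Lemma prod_sqr_dist i e : (0 < i)%N ->
  (e`! * (e + 2 * i)`!)%:R = 2 * (i ^ 2)%:R * \prod_(1 <= j < (e + i).+1) sqd i j.
Proof.
move=> i0; elim: e => [|e IH].
  rewrite !add0n fact0 mul1n big_nat_recr //= [sqd i i]/sqd eqxx mulr1.
  have E : \prod_(1 <= j < i) sqd i j = (\prod_(1 <= j < i) (i ^ 2 - j ^ 2))%:R.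
    rewrite natr_prod; apply: eq_big_nat => j /andP[j1 ji].
    rewrite /sqd ifF; last by lia.
    by rewrite natrB ?leq_exp2r 1?ltnW // ger0_norm // subr_ge0 ler_nat leq_exp2r // ltnW.
  have := @prod_sqr_diff_below i i; rewrite i0 leqnn subnn fact0 muln1 => /(_ isT) H.
  rewrite E -!natrM; congr (_%:R).
  have -> : (2 * i = (i + i).-1.+1)%N by lia.
  rewrite factS -H; have -> : ((i + i).-1.+1 = 2 * i)%N by lia.
  ring.
rewrite addSn big_nat_recr //= mulrA -IH.
have -> : sqd i (e + i).+1 = (e.+1 * (e + 2 * i).+1)%:R.
  rewrite /sqd ifF; last by lia.
  have -> : (e.+1 * (e + 2 * i).+1 = (e + i).+1 ^ 2 - i ^ 2)%N.
    by rewrite subn_sqr; congr (_ * _)%N; lia.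
  rewrite natrB ?leq_exp2r //; last by lia.
  by rewrite distrC ger0_norm // subr_ge0 ler_nat leq_exp2r //; lia.
rewrite -natrM; congr (_%:R); rewrite !factS; ring.
Qed.

(** This is log-convexity of the factorial. *)
Lemma fact_sqr_le i e : ((e + i)`! * (e + i)`! <= e`! * (e + 2 * i)`!)%N.
Proof.
elim: i e => [|i IH] e; first by rewrite muln0 addn0.
rewrite addnS -addSn; apply: leq_trans (IH e.+1) _.
have -> : (e + 2 * i.+1 = (e.+1 + 2 * i).+1)%N by lia.
rewrite (factS (e.+1 + 2 * i)) mulnA; apply: leq_mul => //.
by rewrite factS mulnC leq_mul2l; apply/orP; right; lia.
Qed.

Let top d : F := \prod_(1 <= j < d.+1) (8 * j ^ 2)%:R.

Lemma top_fact d : top d = 8 ^+ d * (d`! * d`!)%:R.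
Proof.
rewrite /top; elim: d => [|d IH]; first by rewrite big_geq // expr0 mul1r.
rewrite big_nat_recr //= IH !factS exprS -!natrX -!natrM; congr (_%:R).
rewrite (expnS _ 1) expn1; ring.
Qed.

Lemma top_gt0 d : 0 < top d.
Proof. by rewrite top_fact mulr_gt0 ?exprn_gt0 ?ltr0n // muln_gt0 fact_gt0. Qed.

(** The ratio of the two products is the partial Wallis product of [1 - 1 / (4 j ^ 2)]. The
    induction needs the sharper lower bound [(d + 2) / (2 (d + 1))] for it, which always exceeds
    [1 / 2]. *)
Lemma top_le_prod_sub2 d : top d <= 2 * \prod_(1 <= j < d.+1) ((8 * j ^ 2)%:R - 2).
Proof.
pose Q e : F := \prod_(1 <= j < e.+1) ((8 * j ^ 2)%:R - 2).
rewrite -/(Q d).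
have Q_ge0 e : 0 <= Q e.
  rewrite /Q big_nat; apply: prodr_ge0 => j /andP[j1 _].
  by rewrite subr_ge0 ler_nat; nia.
suff : (d.+2)%:R * top d <= 2 * (d.+1)%:R * Q d.
  rewrite mulrAC; have := Q_ge0 d; rewrite -(natr1 d.+1) => q0 H.
  have := top_gt0 d => t0.
  have d1 : 0 < (d.+1)%:R :> F by rewrite ltr0n.
  by rewrite -(ler_pM2l d1); nra.
elim: d => [|d IH].
  by rewrite /Q /top !big_geq // !mulr1.
have -> : top d.+1 = top d * (8 * d.+1 ^ 2)%:R by rewrite /top big_nat_recr.
have -> : Q d.+1 = Q d * ((8 * d.+1 ^ 2)%:R - 2) by rewrite /Q big_nat_recr.
have t0 := top_gt0 d; have q0 := Q_ge0 d.
have e1 : 1 <= (d.+1)%:R :> F by rewrite ler1n.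
rewrite -(natr1 d.+2) -!(natr1 d.+1) in IH *.
rewrite natrM natrX; set e := (d.+1)%:R in IH e1 *.
have e0 : 0 < e by lra.
rewrite -(ler_pM2l e0).
have H1 : (e + 1) * (8 * e ^+ 2 - 2) * ((e + 1) * top d) <=
          (e + 1) * (8 * e ^+ 2 - 2) * (2 * e * Q d).
  by apply: ler_wpM2l => //; apply: mulr_ge0; nra.
have H2 : 0 <= (6 * e ^+ 2 - 4 * e - 2) * top d by apply: mulr_ge0; nra.
nra.
Qed.

Lemma sum_inv_sqr_le d : \sum_(1 <= j < d.+1) (j ^ 2)%:R^-1 <= 2 :> F.
Proof.
suff : \sum_(1 <= j < d.+1) (j ^ 2)%:R^-1 <= 2 - 2 / (d.+1)%:R :> F.
  by move=> /le_trans; apply; rewrite gerBl divr_ge0.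
elim: d => [|d IH]; first by rewrite big_geq // divr1 subrr.
rewrite big_nat_recr //=; apply: le_trans (lerD IH (lexx _)) _.
rewrite natrX -(natr1 d.+1); set e := (d.+1)%:R.
have e1 : 1 <= e :> F by rewrite ler1n.
have -> : 2 - 2 / (e + 1) = 2 - 2 / e + (e ^+ 2)^-1 * (2 * e / (e + 1)).
  field; lra.
rewrite lerD2l ler_peMr ?invr_ge0 ?sqr_ge0 // ler_pdivlMr; lra.
Qed.

(** The diagonal value [1] again removes the vanishing factor, so that [wden d t] below is the
    absolute value of the divided difference denominator at node [t]. *)
Let ndist (t s : nat) : F := if s == t then 1 else `|(node t)%:R - (node s)%:R|.
Let wden d t : F := \prod_(0 <= s < d.+3) ndist t s.

Lemma wdenE d t : wden d t =
  ndist t 0 * (ndist t 1 * (ndist t 2 * \prod_(1 <= i < d.+1) ndist t (i + 2))).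
Proof.
rewrite /wden 3?big_ltn // -[3%N]/(1 + 2)%N big_addn.
by have -> : (d.+3 - 2 = d.+1)%N by lia.
Qed.

Lemma wden_gt0 d t : 0 < wden d t.
Proof.
apply: prodr_gt0 => s _; rewrite /ndist; case: eqP => // /eqP st.
by rewrite normr_gt0 subr_eq0 eqr_nat eq_sym; apply: contra st => /eqP/node_inj->.
Qed.

Lemma wden0 d : wden d 0 = 2 * top d.
Proof.
rewrite wdenE /ndist /= !sub0r !normrN !normr_nat !mul1r; congr (_ * _).
apply: eq_big_nat => i /andP[i0 _].
by rewrite addn_eq0 andbF sub0r normrN normr_nat node_tail.
Qed.

Lemma prod_ndist_ge d t : (t <= 2)%N ->
  \prod_(1 <= i < d.+1) ((8 * i ^ 2)%:R - 2) <= \prod_(1 <= i < d.+1) ndist t (i + 2).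
Proof.
move=> t2; rewrite big_nat [leRHS]big_nat; apply: ler_prod => i /andP[i0 _].
rewrite subr_ge0 ler_nat; apply/andP; split; first by nia.
rewrite /ndist ifF; last by lia.
rewrite node_tail // /node t2 distrC ger0_norm.
  by rewrite lerD2l lerN2 ler_nat.
by rewrite subr_ge0 ler_nat; nia.
Qed.

Lemma wden0_le1 d : wden d 0 <= 4 * wden d 1.
Proof.
rewrite wden0 wdenE /ndist /= {1 2}/node /= subr0 normr1 !mul1r.
rewrite -[X in _ * (X * _)]normrN opprB -natrB // normr1 mul1r.
by have := @prod_ndist_ge d 1 isT; have := top_le_prod_sub2 d; rewrite /ndist; lra.
Qed.

Lemma wden0_le2 d : wden d 0 <= 2 * wden d 2.
Proof.
rewrite wden0 wdenE /ndist /= {1 2 3 4}/node /= subr0 normr_nat !mul1r.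
rewrite -natrB // normr1 mul1r.
by have := @prod_ndist_ge d 2 isT; have := top_le_prod_sub2 d; rewrite /ndist; lra.
Qed.

(** Let [R] be the product of the distances to the other nodes [8 j ^ 2]. The factorial identities
    give [top d <= 16 i ^ 2 R], and the nodes [1] and [2] contribute
    [(8 i ^ 2 - 1) (8 i ^ 2 - 2) >= 40 i ^ 4]: this is the source of the decay of the weights. *)
Lemma wden0_le_tail d i : (0 < i <= d)%N ->
  wden d 0 * (10 * (i ^ 2)%:R * (i ^ 2)%:R) <= wden d (i + 2).
Proof.
move=> /andP[i0 id]; rewrite wden0.
(* The index [j = i] contributes [1] on the left; the leading [8] makes up for its missing
   factor. *)
have prodE : 8 * \prod_(1 <= j < d.+1) ndist (i + 2) (j + 2) =
    8 ^+ d * \prod_(1 <= j < d.+1) sqd i j.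
  have E1 : 8 = \prod_(1 <= j < d.+1) (if j == i then 8 else 1) :> F.
    by rewrite -big_mkcond /= big_nat1_eq ifT //; lia.
  have E2 : 8 ^+ d = \prod_(1 <= j < d.+1) 8 :> F.
    by rewrite prodr_const_nat subn1.
  rewrite E2 [X in X * _ = _]E1 -!big_split; apply: eq_big_nat => j /andP[j0 _] /=.
  rewrite /ndist /sqd eqn_add2r; case: ifP => [_|ji]; first by rewrite mulr1.
  by rewrite mul1r !node_tail // !natrM -mulrBr normrM normr_nat.
have topP : top d <= 2 * (i ^ 2)%:R * (8 * \prod_(1 <= j < d.+1) ndist (i + 2) (j + 2)).
  rewrite prodE top_fact mulrCA ler_pM2l ?exprn_gt0 // -[d](subnK id).
  by rewrite -prod_sqr_dist // ler_nat fact_sqr_le.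
rewrite wdenE; set R := \prod_(1 <= j < d.+1) _ in topP *.
rewrite /ndist /=.
have -> : (1%N == i + 2)%N = false by lia.
have -> : (2%N == i + 2)%N = false by lia.
have -> : (0%N == i + 2)%N = false by lia.
rewrite {2 4 6}/node /= subr0 normr_nat node_tail //.
have y1 : 1 <= (i ^ 2)%:R :> F by rewrite ler1n expn_gt0 i0.
rewrite natrM; set y := (i ^ 2)%:R in topP y1 *.
rewrite !ger0_norm; try lra.
have t0 := top_gt0 d.
have R0 : 0 < R by nra.
apply: (@le_trans _ _ (8 * y * R * (40 * (y * y)))).
  have -> : 2 * top d * (10 * y * y) = top d * (20 * (y * y)) by ring.
  have -> : 8 * y * R * (40 * (y * y)) = (2 * y * (8 * R)) * (20 * (y * y)) by ring.
  by apply: ler_wpM2r => //; nra.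
have -> : 8 * y * ((8 * y - 1) * ((8 * y - 2) * R)) =
  8 * y * R * ((8 * y - 1) * (8 * y - 2)) by ring.
by apply: ler_wpM2l; nra.
Qed.

(** The divided difference weights are scaled to [v ord0 = 1] and then divided by their total
    variation [S]. Since [1 <= S <= 8], the mass at [0] is [S^-1 >= 1 / 8], and the [d + 3] nodes
    cancel all degrees below [d + 2]. *)
Lemma base_kernel d : (0 < d)%N ->
  exists (O : finType) (P A : O -> F) (N : O -> nat),
    kernel (8 * d ^ 2) d.+2 10 8^-1 P A N.
Proof.
move=> d0; pose x (t : 'I_d.+3) : F := (node t)%:R.
pose w t := \prod_(s < d.+3 | s != t) (x t - x s).
have wabs t : `|w t| = wden d t.
  rewrite normr_prod /wden big_mkord big_mkcond; apply: eq_bigr => s _.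
  by rewrite /ndist -val_eqE /=; case: eqP.
have x_inj : injective x.
  by move=> s t /eqP; rewrite eqr_nat => /eqP/node_inj/val_inj.
pose v t := w ord0 / w t.
have vabs t : `|v t| = wden d 0 / wden d t by rewrite normrM normfV !wabs.
pose b j : F := wden d 0 / wden d j.
have b0 : b 0%N = 1 by rewrite /b divff // gt_eqF // wden_gt0.
have b1 : b 1%N <= 4 by rewrite ler_pdivrMr ?wden_gt0 // wden0_le1.
have b2 : b 2%N <= 2 by rewrite ler_pdivrMr ?wden_gt0 // wden0_le2.
have bi i : (0 < i <= d)%N -> b (i + 2)%N * (10 * (i ^ 2)%:R) <= (i ^ 2)%:R^-1.
  move=> hi; have y0 : 0 < (i ^ 2)%:R :> F by rewrite ltr0n expn_gt0; lia.
  rewrite -[leRHS]mul1r ler_pdivlMr // -mulrA /b mulrAC ler_pdivrMr ?wden_gt0 //.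
  by rewrite mul1r wden0_le_tail.
have sumb (f : nat -> F) : \sum_(t < d.+3) `|v t| * f t =
    f 0%N + (b 1%N * f 1%N + (b 2%N * f 2%N + \sum_(1 <= i < d.+1) b (i + 2)%N * f (i + 2)%N)).
  under eq_bigr do rewrite vabs.
  rewrite -(big_mkord xpredT (fun t => b t * f t)) 3?big_ltn // b0 mul1r.
  by rewrite -[3%N]/(1 + 2)%N big_addn; have -> : (d.+3 - 2 = d.+1)%N by lia.
pose S : F := \sum_(t < d.+3) `|v t|.
have SE : S = \sum_(t < d.+3) `|v t| * 1 by apply: eq_bigr => t _; rewrite mulr1.
have b_ge0 j : 0 <= b j by rewrite divr_ge0 // ltW // wden_gt0.
(* The nodes [0], [1], [2] contribute at most [1 + 4 + 2], and the others at most [2 / 10]. *)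
have S8 : S <= 8.
  rewrite SE (sumb (fun=> 1)) !mulr1.
  have : \sum_(1 <= i < d.+1) b (i + 2)%N * 1 <= 10^-1 * \sum_(1 <= i < d.+1) (i ^ 2)%:R^-1.
    rewrite mulr_sumr big_nat [leRHS]big_nat; apply: ler_sum => i hi; rewrite mulr1.
    have := bi i hi; have y1 : 1 <= (i ^ 2)%:R :> F by rewrite ler1n expn_gt0; lia.
    by have := b_ge0 (i + 2)%N; nra.
  have := sum_inv_sqr_le d; lra.
have S1 : 1 <= S.
  rewrite SE (sumb (fun=> 1)) lerDl !mulr1; apply: addr_ge0 => //; apply: addr_ge0 => //.
  by apply: sumr_ge0 => i _; rewrite mulr1.
(* The node [1] contributes at most [4], the node [2] at most [2 * 2], and the others at most
   [2]. *)
have mean10 : \sum_(t < d.+3) `|v t| * x t <= 10.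
  rewrite (sumb (fun j => (node j)%:R)) {1 2 3}/node /= add0r mulr1.
  have : \sum_(1 <= i < d.+1) b (i + 2)%N * (node (i + 2))%:R <=
      \sum_(1 <= i < d.+1) (i ^ 2)%:R^-1.
    rewrite big_nat [leRHS]big_nat; apply: ler_sum => i hi.
    rewrite node_tail; last by lia.
    apply: le_trans (bi i hi); rewrite ler_wpM2l // natrM.
    by apply: ler_wpM2r; rewrite ?ler0n // ler_nat.
  have := sum_inv_sqr_le d; lra.
have S0 : 0 < S by lra.
exists 'I_d.+3, (fun t => `|v t| / S), (fun t => v t / S), (fun t : 'I_d.+3 => node t).
split=> [t||t|i iL||].
- by rewrite normrM normfV (gtr0_norm S0).
- by rewrite -mulr_suml divff // gt_eqF.
- exact: node_le.
(* The falling factorial polynomial takes the value [i! 'C(node t, i)] at node [t]. *)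
- pose p : {poly F} := \prod_(j < i) ('X - (j%:R)%:P).
  have sp : (size p < d.+3)%N by rewrite /p -big_enum size_prod_XsubC -cardE card_ord.
  have := sum_divided_difference x_inj sp => H.
  have -> : \sum_(t < d.+3) v t / S * 'C(node t, i)%:R =
      (w ord0 / S / (i`!)%:R) * \sum_(t < d.+3) p.[x t] * (w t)^-1; last by rewrite H mulr0.
  rewrite mulr_sumr; apply: eq_bigr => t _; rewrite ffact_polyE -bin_ffact natrM /v.
  by field; rewrite -normr_gt0 wabs wden_gt0 pnatr_eq0 -lt0n fact_gt0 gt_eqF.
- rewrite (eq_bigr (fun t => S^-1 * (`|v t| * x t))) => [|t _]; last by rewrite /x; ring.
  rewrite -mulr_sumr ler_pdivrMl //; nra.
- have zE : (fun t : 'I_d.+3 => node t == 0%N) =1 pred1 ord0.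
    by move=> t; rewrite -[0%N]/(node 0) (inj_eq node_inj).
  rewrite (big_pred1 _ zE).
  by rewrite /v divff ?mul1r ?lef_pV2 ?posrE // -normr_gt0 wabs wden_gt0.
Qed.

End BaseKernel.

(** * Cancellation for a uniformly random subset of random size *)

Section RandomSubsets.

Variables (F : realFieldType) (T : finType).

(** Möbius inversion on subsets: [H I] is the alternating sum of [G J] over the [2 ^ #|I|] subsets
    [J] of [I]. *)
Lemma subset_expansion (G : {set T} -> F) : (forall Y, `|G Y| <= 1) ->
  exists H : {set T} -> F, (forall I, `|H I| <= 2 ^+ #|I|) /\
    forall Y, G Y = \sum_(I : {set T} | I \subset Y) H I.
Proof.
move=> G1.
(* The Möbius function, [(-1) ^ #|I :\: J|] if [J] lies in [I] and [0] otherwise, written as a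
   product over points so that its sums over [I] factor. *)
pose sg (J I : {set T}) : F :=
  \prod_b (if b \in I then if b \in J then 1 else -1 else (b \notin J)%:R).
have sg_norm J I : `|sg J I| = (J \subset I)%:R.
  rewrite normr_prod; have [/subsetP JI|/subsetPn[b bJ bI]] := boolP (J \subset I).
    rewrite big1 // => b _; case: ifP => bI; first by case: ifP; rewrite ?normrN normr1.
    by rewrite (contraFN (JI b) bI) normr1.
  by rewrite (bigD1 b) //= (negPf bI) bJ normr0 mul0r.
have sg_inv (J Y : {set T}) : \sum_(I : {set T} | I \subset Y) sg J I = (J == Y)%:R.
  pose al b : F := if b \in Y then if b \in J then 1 else -1 else 0.
  pose be b : F := (b \notin J)%:R.
  have H := @bigA_distr F 0 1 *%R +%R T al be.
  transitivity (\prod_b (al b + be b)).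
    rewrite H big_mkcond; apply: eq_bigr => I _.
    case: ifPn => [/subsetP IY|/subsetPn[b bI bY]].
      by apply: eq_bigr => b _; rewrite /al /be; case: ifP => // /IY ->.
    by rewrite (bigD1 b) //= bI /al (negPf bY) mul0r.
  have [JYE|JY] := eqVneq J Y.
    by rewrite big1 // => b _; rewrite /al /be JYE; case: (b \in Y); rewrite ?addr0 ?add0r.
  have /existsP[b bJY] : [exists b, (b \in J) != (b \in Y)].
    apply: contraNT JY => /existsPn JY; apply/eqP/setP => b.
    by apply/eqP; have := JY b; rewrite negbK.
  rewrite (bigD1 b) //= /al /be; move: bJY.
  by case: (b \in J); case: (b \in Y) => //= _; rewrite ?addNr ?addr0 mul0r.
exists (fun I => \sum_J sg J I * G J); split=> [I|Y].
  apply: le_trans (ler_norm_sum _ _ _) _.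
  apply: (@le_trans _ _ (\sum_(J : {set T}) (J \subset I)%:R)).
    by apply: ler_sum => J _; rewrite normrM sg_norm ler_piMr.
  rewrite -natr_sum -natrX ler_nat -big_mkcond sum1_card -card_powerset subset_leq_card //.
  by apply/subsetP => J; rewrite inE.
rewrite exchange_big /=; under eq_bigr do rewrite -mulr_suml sg_inv.
rewrite (bigD1 Y) //= eqxx mul1r big1 ?addr0 // => J /negPf->.
by rewrite mul0r.
Qed.

Lemma bin_subset_mul K N i : (i <= N <= K)%N ->
  ('C(K - i, N - i) * 'C(K, i) = 'C(K, N) * 'C(N, i))%N.
Proof.
move=> /andP[iN NK]; have iK := leq_trans iN NK.
have a0 : (0 < i`! * (N - i)`! * (K - N)`!)%N by rewrite !muln_gt0 !fact_gt0.
apply/eqP; rewrite -(eqn_pmul2r a0); apply/eqP.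
have e1 := bin_fact iK; have e2 := bin_fact NK; have e3 := bin_fact iN.
have := @bin_fact (K - i) (N - i); rewrite leq_sub2r // => /(_ isT).
have -> : (K - i - (N - i) = K - N)%N by lia.
move=> e4.
transitivity (K`!).
  rewrite -e1 -e4; ring.
rewrite -e2 -e3; ring.
Qed.

(** In other words, a uniform [N]-subset of [W] contains [I] with probability
    ['C(N, #|I|) / 'C(#|W|, #|I|)]; this is where binomial moments of the multiplicity enter. *)
Lemma card_between (I W : {set T}) N : I \subset W ->
  (#|[set Z : {set T} | [&& I \subset Z, Z \subset W & #|Z| == N]]| * 'C(#|W|, #|I|)
   = 'C(#|W|, N) * 'C(N, #|I|))%N.
Proof.
move=> IW; set S := [set Z | _].
have [iN|Ni] := leqP #|I| N; last first.
  rewrite (bin_small Ni) muln0; have -> : S = set0; last by rewrite cards0.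
  apply/setP => Z; rewrite !inE; apply/negbTE/negP => /and3P[/subset_leq_card IZ _ /eqP ZN].
  by move: IZ; rewrite ZN leqNgt Ni.
have -> : #|S| = 'C(#|W| - #|I|, N - #|I|).
  have -> : (#|W| - #|I|)%N = #|W :\: I| by rewrite cardsD (setIidPr IW).
  rewrite -cards_draws.
  have inj : {in S &, injective (fun Z : {set T} => Z :\: I)}.
    move=> Z Z'; rewrite !inE => /and3P[IZ _ _] /and3P[IZ' _ _] E.
    by rewrite -(setID Z I) -(setID Z' I) E (setIidPr IZ) (setIidPr IZ').
  rewrite -(card_in_imset inj); apply: eq_card => Y.
  rewrite inE; apply/imsetP/andP => [[Z]|[YW /eqP Yc]].
    rewrite inE => /and3P[IZ ZW /eqP Zc] ->; split; first exact: setSD.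
    by rewrite cardsD (setIidPr IZ) Zc.
  have dis : [disjoint Y & I].
    by move: YW; rewrite subsetD => /andP[].
  exists (Y :|: I).
    rewrite inE subsetUr subUset IW (subset_trans YW (subsetDl _ _)) /=.
    rewrite cardsU; move/disjoint_setI0: (dis) ->; rewrite cards0 Yc; lia.
  rewrite setDUl setDv setU0; apply/esym/setDidPl; exact: dis.
have [NW|WN] := leqP N #|W|; first by rewrite bin_subset_mul // iN.
have WiNi : (#|W| - #|I| < N - #|I|)%N by have := subset_leq_card IW; lia.
by rewrite (bin_small WN) (bin_small WiNi).
Qed.

Lemma bin_ratio_le r K i : (r <= K)%N -> ('C(r, i) * K ^ i <= 'C(K, i) * r ^ i)%N.
Proof.
move=> rK; rewrite -(leq_pmul2r (fact_gt0 i)) mulnAC bin_ffact [leqRHS]mulnAC bin_ffact.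
elim: i => [|i IH]; first by [].
rewrite !ffactnSr !expnSr.
have -> : (r ^_ i * (r - i) * (K ^ i * K) = r ^_ i * K ^ i * ((r - i) * K))%N by ring.
have -> : (K ^_ i * (K - i) * (r ^ i * r) = K ^_ i * r ^ i * ((K - i) * r))%N by ring.
by apply: leq_mul => //; nia.
Qed.

(** Combine ['C(m, i) i! <= m ^ i] with [i ^ i <= (2i) ^_ i = 'C(2i, i) i! <= 4 ^ i i!]. *)
Lemma bin_pow_le m i : ('C(m, i) * i ^ i <= (4 * m) ^ i)%N.
Proof.
rewrite -(leq_pmul2r (fact_gt0 i)) mulnAC bin_ffact expnMn.
have le1 n j : (n ^_ j <= n ^ j)%N.
  by elim: j => // j IH; rewrite ffactnSr expnSr leq_mul // leq_subr.
have le2 : (i ^ i <= (i + i) ^_ i)%N.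
  have : forall j, (j <= i)%N -> (i ^ j <= (i + i) ^_ j)%N.
    elim=> // j IH ji; rewrite ffactnSr expnSr leq_mul ?IH //; lia.
  by apply.
have le3 : ('C(i + i, i) <= 4 ^ i)%N.
  rewrite -[4%N]/(2 ^ 2)%N -expnM mul2n -addnn.
  rewrite -[2%N]/(1 + 1)%N expnDn (bigD1 (inord i)) //= !exp1n !muln1 inordK; last by lia.
  exact: leq_addr.
have -> : (4 ^ i * m ^ i * i`! = m ^ i * (4 ^ i * i`!))%N by ring.
apply: leq_mul (le1 _ _) _; apply: leq_trans le2 _.
by rewrite -bin_ffact leq_mul2r le3 orbT.
Qed.

Lemma sum_geometric_tail L m : \sum_(L <= i < m) 2 ^- i <= 2 / 2 ^+ L :> F.
Proof.
have p0 i : 0 < 2 ^+ i :> F by rewrite exprn_gt0.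
have [Lm|mL] := leqP L m; last first.
  by rewrite big_geq ?divr_ge0 ?ltW // ltnW.
suff : \sum_(L <= i < m) 2 ^- i <= 2 / 2 ^+ L - 2 / 2 ^+ m :> F.
  by move/le_trans; apply; rewrite gerBl divr_ge0 // ltW.
rewrite -(subnKC Lm); elim: (m - L)%N => [|e IH].
  by rewrite addn0 big_geq // subrr.
rewrite addnS big_nat_recr ?leq_addr //=; apply: le_trans (lerD IH (lexx _)) _.
rewrite exprS invfM mulrA divff ?pnatr_eq0 // mul1r.
by set y := (2 ^+ (L + e))^-1; lra.
Qed.

Variables (m L : nat) (mu g : F) (O : finType) (P A : O -> F) (N : O -> nat).
Hypothesis ker : kernel m L mu g P A N.

Lemma kernel_moment_le i : `|\sum_w A w * 'C(N w, i)%:R| <= 'C(m, i)%:R.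
Proof.
apply: le_trans (ler_norm_sum _ _ _) _.
rewrite -[leRHS]mul1r -[X in _ <= X * _](kernel_mass ker) mulr_suml; apply: ler_sum => w _.
rewrite normrM normr_nat; apply: ler_pM => //; first exact: kernel_abs ker w.
rewrite ler_nat; apply: leq_bin2l; exact: kernel_max ker w.
Qed.

(** Expanding [G] over subsets [I] of [W :&: D] turns each average into a combination of
    ['C(N w, #|I|)], so that summing against [A] leaves only its moments of order at least [L]. *)
Lemma random_subset_cancel (W D : {set T}) (G : {set T} -> F) :
  (forall Y, `|G Y| <= 1) -> (0 < L)%N -> (0 < #|W|)%N -> (m <= #|W|)%N ->
  (16 * #|D| * m <= #|W| * L)%N ->
  `|\sum_w A w * ((\sum_(Z : {set T} | (Z \subset W) && (#|Z| == N w)) G (Z :&: D))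
       / 'C(#|W|, N w)%:R)| <= 2 / 2 ^+ L.
Proof.
move=> G1 L0 W0 mW DmW; have [H [H_le GE]] := subset_expansion G1.
pose K := #|W|; pose mom i := \sum_w A w * 'C(N w, i)%:R.
have binK i : (i <= K)%N -> 'C(K, i)%:R != 0 :> F.
  by move=> iK; rewrite pnatr_eq0 -lt0n bin_gt0.
have avgE w : (\sum_(Z : {set T} | (Z \subset W) && (#|Z| == N w)) G (Z :&: D))
     / 'C(K, N w)%:R =
    \sum_(I : {set T} | I \subset W :&: D) H I * ('C(N w, #|I|)%:R / 'C(K, #|I|)%:R).
  under eq_bigr do rewrite GE big_mkcond.
  rewrite exchange_big /= mulr_suml [RHS]big_mkcond; apply: eq_bigr => I _.
  rewrite subsetI; under eq_bigr do rewrite subsetI.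
  case: (boolP (I \subset D)) => ID; last first.
    by rewrite andbF big1 ?mul0r // => Z _; rewrite andbF.
  rewrite andbT; under eq_bigr do rewrite andbT.
  rewrite -big_mkcondr /= sumr_const /=.
  case: ifPn => [IW|IW]; last first.
    rewrite [X in _ *+ X](_ : _ = 0%N) ?mulr0n ?mul0r //; apply: eq_card0 => Z; rewrite !inE.
    by apply/negbTE/negP => /andP[/andP[ZW _] IZ]; move: IW; rewrite (subset_trans IZ ZW).
  have := card_between (N w) IW; rewrite -/K.
  set c := #|[set Z | _]| => cE.
  rewrite [X in _ *+ X](_ : _ = c); last first.
    by rewrite /c; apply: eq_card => Z; rewrite !inE unfold_in /= andbC.
  have iK : (#|I| <= K)%N by apply: subset_leq_card.
  have NK : (N w <= K)%N by apply: leq_trans (kernel_max ker w) mW.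
  rewrite -[_ *+ c]mulr_natr -mulrA; congr (_ * _).
  apply: (mulIf (binK _ iK)); rewrite mulrAC -natrM cE natrM mulrAC divff ?binK // mul1r.
  by rewrite mulfVK ?binK.
under eq_bigr do rewrite avgE mulr_sumr.
rewrite exchange_big /=.
have -> : \sum_(I : {set T} | I \subset W :&: D)
     \sum_w A w * (H I * ('C(N w, #|I|)%:R / 'C(K, #|I|)%:R)) =
   \sum_(I : {set T} | I \subset W :&: D) H I * mom #|I| / 'C(K, #|I|)%:R.
  apply: eq_bigr => I _; rewrite /mom mulr_sumr mulr_suml; apply: eq_bigr => w _; ring.
apply: le_trans (ler_norm_sum _ _ _) _.
pose r := #|W :&: D|.
have rK : (r <= K)%N by apply: subset_leq_card; apply: subsetIl.
have rD : (r <= #|D|)%N by apply: subset_leq_card; apply: subsetIr.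
pose c i : F := 2 ^+ i * `|mom i| / 'C(K, i)%:R.
apply: (@le_trans _ _ (\sum_(I : {set T} | I \subset W :&: D) c #|I|)).
  apply: ler_sum => I _; rewrite /c !normrM normfV normr_nat.
  by rewrite ler_wpM2r ?invr_ge0 // ler_wpM2r.
have -> : \sum_(I : {set T} | I \subset W :&: D) c #|I| =
    \sum_(0 <= i < r.+1) 'C(r, i)%:R * c i.
  rewrite big_mkord (partition_big (fun I : {set T} => inord #|I| : 'I_r.+1) xpredT) //=.
  apply: eq_bigr => i _; rewrite (eq_bigr (fun=> c i)) => [|I /andP[IW /eqP <-]]; last first.
    by rewrite inordK // ltnS subset_leq_card.
  rewrite sumr_const -[LHS]mulr_natl -cards_draws; congr (_%:R * _).
  apply: eq_card => I; rewrite !inE unfold_in /=; case: (boolP (I \subset _)) => //= IW.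
  by rewrite -val_eqE /= inordK // ltnS subset_leq_card.
apply: (@le_trans _ _ (\sum_(0 <= i < r.+1) if (L <= i)%N then 2 ^- i else 0)); last first.
  rewrite -big_mkcond /=; have [Lr|rL] := leqP L r.+1; last first.
    rewrite big_nat_cond big_pred0 ?divr_ge0 ?exprn_ge0 // => i.
    by lia.
  rewrite (big_cat_nat (leq0n L) Lr) /= big_nat_cond big_pred0 ?add0r => [|i]; last by lia.
  rewrite big_nat_cond (eq_bigl (fun i => (L <= i < r.+1)%N && true)) => [|i]; last by lia.
  by rewrite -big_nat_cond sum_geometric_tail.
rewrite big_nat [leRHS]big_nat; apply: ler_sum => i /andP[_ ir].
case: ifPn => [Li|]; last first.
  by rewrite -ltnNge => iL; rewrite /c /mom (kernel_cancel ker) // normr0 mulr0 mul0r mulr0.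
have iK : (i <= K)%N by lia.
rewrite /c mulrA ler_pdivrMr ?ltr0n ?bin_gt0 // mulrC -mulrA ler_pdivlMl ?exprn_gt0 //.
apply: (@le_trans _ _ (2 ^+ i * (2 ^+ i * 'C(m, i)%:R * 'C(r, i)%:R))).
  rewrite ler_wpM2l ?exprn_ge0 // -!mulrA ler_wpM2l ?exprn_ge0 //.
  by rewrite ler_wpM2r // kernel_moment_le.
rewrite -!natrX -!natrM ler_nat.
have KL0 : (0 < (K * L) ^ i)%N by rewrite expn_gt0 muln_gt0 W0 L0.
rewrite -(leq_pmul2r KL0) expnMn.
(* With denominators cleared: [2 ^ i 'C(m, i) 'C(r, i) / 'C(K, i)] is at most [(8 m r / (i K)) ^ i],
   hence at most [2 ^- i] because [i >= L] and [16 r m <= K L]. *)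
have h1 := bin_ratio_le i rK; have h2 := bin_pow_le m i.
have h3 : (L ^ i <= i ^ i)%N by rewrite leq_exp2r //; lia.
have h4 : ((16 * r * m) ^ i <= (K * L) ^ i)%N.
  by rewrite leq_exp2r; [apply: leq_trans DmW; rewrite -!mulnA !leq_mul2l; nia | lia].
apply: (@leq_trans ((2 ^ i * 2 ^ i) * ('C(m, i) * i ^ i) * ('C(r, i) * K ^ i))).
  rewrite [leqRHS](_ : _ = 2 ^ i * 2 ^ i * 'C(m, i) * 'C(r, i) * K ^ i * i ^ i)%N; last by ring.
  rewrite [leqLHS](_ : _ = 2 ^ i * 2 ^ i * 'C(m, i) * 'C(r, i) * K ^ i * L ^ i)%N; last by ring.
  by rewrite leq_mul2l h3 orbT.
apply: (@leq_trans ((2 ^ i * 2 ^ i) * (4 * m) ^ i * ('C(K, i) * r ^ i))).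
  by apply: leq_mul => //; rewrite leq_mul2l h2 orbT.
apply: (@leq_trans ('C(K, i) * (16 * r * m) ^ i)); last first.
  by rewrite leq_mul2l -expnMn h4 orbT.
rewrite leq_eqVlt; apply/orP; left; apply/eqP.
rewrite -[16%N]/(2 * 2 * 4)%N !expnMn; ring.
Qed.

End RandomSubsets.

(** * Uniform colorings with prescribed color counts *)

Section ColoringsWithCounts.

Variables (F : realFieldType) (B : finType) (M : nat).

Local Notation coloring := {ffun B -> 'I_M.+1}.

Definition color_class (u : coloring) (c : 'I_M.+1) : {set B} := [set b | u b == c].

(* Color [ord0] is the filler: its count is whatever the others leave over. *)
Definition colorings (x : 'I_M -> nat) : {set coloring} :=
  [set u : coloring | [forall j, #|color_class u (lift ord0 j)| == x j]].

Definition update (x : 'I_M -> nat) (j : 'I_M) (y : nat) : 'I_M -> nat :=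
  fun i => if i == j then y else x i.

Definition recolor (v : coloring) (Z : {set B}) (c : 'I_M.+1) : coloring :=
  [ffun b => if b \in Z then c else v b].

Lemma colorings_ext x x' : x =1 x' -> colorings x = colorings x'.
Proof.
by move=> xx'; apply/setP => u; rewrite !inE; apply: eq_forallb => j; rewrite xx'.
Qed.

Lemma card_filler x u : u \in colorings x ->
  (#|color_class u ord0| + \sum_j x j = #|B|)%N.
Proof.
rewrite inE => /forallP ux.
rewrite (eq_bigr (fun j : 'I_M => #|color_class u (lift ord0 j)|)) => [|j _]; last first.
  by apply/esym/eqP.
rewrite -(big_ord_recl _ (fun c => #|color_class u c|)) /=.
rewrite -sum1_card (partition_big u xpredT) //=; apply: eq_bigr => c _.
by rewrite -sum1_card; apply: eq_bigl => b; rewrite !inE.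
Qed.

(** Erasing color [j] into the filler is inverted by choosing which [y] filler balls to recolor.
    Hence, given everything else, the class of color [j] is a uniform subset of the filler. *)
Lemma sum_colorings_update x j y (Phi : coloring -> F) :
  \sum_(u in colorings (update x j y)) Phi u =
  \sum_(v in colorings (update x j 0))
    \sum_(Z : {set B} | (Z \subset color_class v ord0) && (#|Z| == y))
      Phi (recolor v Z (lift ord0 j)).
Proof.
pose c := lift ord0 j.
have c0 : ord0 != c by rewrite neq_lift.
rewrite pair_big_dep /=.
rewrite (reindex_onto (fun p : coloring * {set B} => recolor p.1 p.2 c)
  (fun u => (recolor u (color_class u c) ord0, color_class u c))) /=; last first.
  move=> u _; apply/ffunP => b; rewrite !ffunE inE.
  by case: eqP => [->|].
apply: eq_bigl => -[v Z] /=.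
have cls (i : 'I_M) : i != j -> Z \subset color_class v ord0 ->
    color_class (recolor v Z c) (lift ord0 i) = color_class v (lift ord0 i).
  move=> ij /subsetP Z0; apply/setP => b; rewrite !inE ffunE; case: ifPn => // bZ.
  have := Z0 b bZ; rewrite inE => /eqP ->; rewrite (inj_eq lift_inj) eq_sym (negPf ij).
  by rewrite (negPf (neq_lift _ _)).
rewrite !inE; apply/andP/and3P => [[/forallP uP /eqP[vE ZE]]|[/forallP vP Z0 /eqP Zy]].
  have Z0 : Z \subset color_class v ord0.
    by apply/subsetP => b bZ; rewrite inE -vE ffunE ZE bZ.
  split=> //; last first.
    by rewrite -ZE; have := uP j; rewrite /update eqxx.
  apply/forallP => i; rewrite /update; case: (eqVneq i j) => [->|ij]; last first.
    by have := uP i; rewrite /update (negPf ij) cls.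
  apply/eqP; apply: eq_card0 => b; rewrite !inE -vE ffunE.
  case: ifPn => [_|]; first by rewrite (negPf c0).
  by rewrite inE => /negPf->.
have vc b : v b != c.
  have := vP j; rewrite /update eqxx => /eqP/cards0_eq/setP/(_ b).
  by rewrite !inE => ->.
have ZE : color_class (recolor v Z c) c = Z.
  apply/setP => b; rewrite !inE ffunE; case: ifP => _; first by rewrite eqxx.
  exact/negbTE/vc.
split.
  apply/forallP => i; rewrite /update; case: (eqVneq i j) => [->|ij].
    by rewrite -/c ZE Zy.
  by have := vP i; rewrite /update (negPf ij) cls.
apply/eqP; congr (_, _) => //; rewrite ZE; apply/ffunP => b; rewrite !ffunE.
by case: (boolP (b \in Z)) => // bZ; have /subsetP/(_ b bZ) := Z0; rewrite inE => /eqP->.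
Qed.

Let others (x : 'I_M -> nat) j := (\sum_(i | i != j) x i)%N.

Lemma card_filler_update x j v : v \in colorings (update x j 0) ->
  (#|color_class v ord0| + others x j = #|B|)%N.
Proof.
move=> vX; rewrite -(card_filler vX) [in RHS](bigD1 j) //= {1}/update eqxx add0n.
by congr (_ + _)%N; apply: eq_bigr => i /negPf ij; rewrite /update ij.
Qed.

Lemma card_colorings_update x j y :
  #|colorings (update x j y)|%:R =
  #|colorings (update x j 0)|%:R * 'C(#|B| - others x j, y)%:R :> F.
Proof.
have := sum_colorings_update x j y (fun=> 1); rewrite sumr_const => ->.
rewrite mulr_natl -sumr_const; apply: eq_bigr => v /card_filler_update <-.
rewrite addnK sumr_const -cards_draws; congr (_%:R).
by apply: eq_card => Z; rewrite !inE.
Qed.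

Lemma colorings_neq0 x : (\sum_j x j <= #|B|)%N -> (0 < #|colorings x|)%N.
Proof.
(* The colors are introduced one at a time; each step multiplies the number of colorings by a
   positive binomial coefficient. *)
move=> xB; pose xl l (j : 'I_M) := if (j < l)%N then x j else 0%N.
suff H l : (l <= M)%N -> (0 < #|colorings (xl l)|)%N.
  by rewrite (@colorings_ext x (xl M)) ?H // => j; rewrite /xl ltn_ord.
elim: l => [_|l IH lM].
  apply/card_gt0P; exists [ffun=> ord0]; rewrite inE; apply/forallP => j.
  by rewrite /xl /= cards_eq0 -subset0; apply/subsetP => b; rewrite !inE ffunE.
pose j := Ordinal lM.
have e1 : xl l.+1 =1 update (xl l) j (x j).
  move=> i; rewrite /xl /update -val_eqE /= ltnS leq_eqVlt.
  by case: (eqVneq (val i) l) => //= il; congr x; apply: val_inj.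
have e0 : xl l =1 update (xl l) j 0.
  by move=> i; rewrite /update; case: eqP => // ->; rewrite /xl /= ltnn.
rewrite (colorings_ext e1) -(ltr0n F) card_colorings_update -(colorings_ext e0).
rewrite mulr_gt0 ?ltr0n ?IH ?bin_gt0 //; first exact: ltnW.
suff : (others (xl l) j + x j <= #|B|)%N by lia.
apply: leq_trans xB; rewrite [leqRHS](bigD1 j) //= addnC leq_add2l.
by apply: leq_sum => i _; rewrite /xl; case: ifP.
Qed.

Definition coloring_mean (Phi : coloring -> F) x : F :=
  (\sum_(u in colorings x) Phi u) / #|colorings x|%:R.

Lemma coloring_mean_norm Phi x : (forall u, `|Phi u| <= 1) -> `|coloring_mean Phi x| <= 1.
Proof.
move=> Phi1; rewrite normrM normfV normr_nat.
have [->|X0] := posnP #|colorings x|; first by rewrite invr0 mulr0.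
rewrite ler_pdivrMr ?ltr0n // mul1r -sumr_const.
by apply: le_trans (ler_norm_sum _ _ _) _; apply: ler_sum.
Qed.

Variables (m L : nat) (mu g : F) (O : finType) (P A : O -> F) (N : O -> nat).
Hypothesis ker : kernel m L mu g P A N.

(** For each coloring [v] with color [j] erased, what is observed on [D] depends on the recolored
    set only through its trace on [D], so the random subset bound applies. The filler size [K] is
    the same for all [v], so averaging over [v] keeps the bound. *)
Lemma coloring_mean_cancel Phi x j (D : {set B}) :
  (forall u, `|Phi u| <= 1) ->
  (forall u u' : coloring, {in D, u =1 u'} -> Phi u = Phi u') ->
  (0 < L)%N -> (others x j < #|B|)%N -> (m + others x j <= #|B|)%N ->
  (16 * #|D| * m <= (#|B| - others x j) * L)%N ->
  `|\sum_w A w * coloring_mean Phi (update x j (N w))| <= 2 / 2 ^+ L.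
Proof.
move=> Phi1 PhiD L0 xB mB DmB.
pose X0 := colorings (update x j 0); pose K := (#|B| - others x j)%N.
have K0 : (0 < K)%N by rewrite subn_gt0.
have NK w : (N w <= K)%N by have := kernel_max ker w; rewrite /K; lia.
pose G v (Z : {set B}) := Phi (recolor v Z (lift ord0 j)).
have meanE w : coloring_mean Phi (update x j (N w)) =
  #|X0|%:R^-1 * \sum_(v in X0) (\sum_(Z : {set B} |
    (Z \subset color_class v ord0) && (#|Z| == N w)) G v (Z :&: D)) / 'C(K, N w)%:R.
  rewrite /coloring_mean card_colorings_update sum_colorings_update.
  rewrite invfM mulrCA; congr (_ * _); rewrite mulr_suml; apply: eq_bigr => v _.
  congr (_ / _); apply: eq_bigr => Z _; apply: PhiD => b bD; rewrite !ffunE inE bD.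
  by rewrite andbT.
under eq_bigr do rewrite meanE mulrCA mulr_sumr.
rewrite -mulr_sumr exchange_big /= normrM normfV normr_nat.
have [->|X0_gt0] := posnP #|X0|; first by rewrite invr0 mul0r divr_ge0 ?exprn_ge0.
rewrite mulrC ler_pdivrMr ?ltr0n // mulr_natr -sumr_const.
apply: le_trans (ler_norm_sum _ _ _) _; apply: ler_sum => v vX.
have KE : #|color_class v ord0| = K by rewrite /K -(card_filler_update vX) addnK.
rewrite -KE; apply: (random_subset_cancel ker); rewrite ?KE // /K.
  by move=> Y; apply: Phi1.
by lia.
Qed.

End ColoringsWithCounts.

(** * Expectations over i.i.d. sequences, and the exchange argument *)

Section IidExpectation.

Variables (F : realFieldType) (O : finType).

Fixpoint expect (mu : O -> F) (M : nat) (f : seq O -> F) : F :=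
  if M is M'.+1 then \sum_w mu w * expect mu M' (fun s => f (w :: s)) else f [::].

Section OneMeasure.

Variable mu : O -> F.
Hypotheses (mu_ge0 : forall w, 0 <= mu w) (mu1 : \sum_w mu w = 1).

Lemma expect_le M f h : (forall s, size s = M -> f s <= h s) ->
  expect mu M f <= expect mu M h.
Proof.
elim: M f h => [|M IH] f h fh; first exact: fh.
apply: ler_sum => w _; apply: ler_wpM2l => //.
by apply: IH => s sM; apply: fh; rewrite /= sM.
Qed.

Lemma eq_expect M f h : f =1 h -> expect mu M f = expect mu M h.
Proof.
by move=> fh; apply/eqP; rewrite eq_le !expect_le // => s _; rewrite fh.
Qed.

Lemma expectD M f h :
  expect mu M (fun s => f s + h s) = expect mu M f + expect mu M h.
Proof.
elim: M f h => [//|M IH] f h /=; rewrite -big_split /=.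
by apply: eq_bigr => w _; rewrite IH mulrDr.
Qed.

Lemma expectZ M a f : expect mu M (fun s => a * f s) = a * expect mu M f.
Proof.
elim: M f => [//|M IH] f /=; rewrite mulr_sumr.
by apply: eq_bigr => w _; rewrite IH mulrCA.
Qed.

Lemma expect_cst M a : expect mu M (fun=> a) = a.
Proof. by elim: M => //= M ->; rewrite -mulr_suml mu1 mul1r. Qed.

Lemma expect_sum M (c : O -> F) f :
  expect mu M (fun s => \sum_w c w * f w s) = \sum_w c w * expect mu M (f w).
Proof.
elim: M f => [//|M IH] f /=.
under eq_bigr do rewrite (IH (fun w s => f w (_ :: s))) mulr_sumr.
rewrite exchange_big; apply: eq_bigr => w _ /=; rewrite mulr_sumr.
by apply: eq_bigr => v _; rewrite mulrCA.
Qed.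

Lemma expect_norm M f h : (forall s, size s = M -> `|f s| <= h s) ->
  `|expect mu M f| <= expect mu M h.
Proof.
move=> fh; rewrite ler_norml; apply/andP; split; last first.
  by apply: expect_le => s sM; apply: le_trans (ler_norm _) (fh s sM).
rewrite -mulN1r -expectZ; apply: expect_le => s sM.
by rewrite mulN1r lerNl; apply: le_trans (fh s sM); rewrite -normrN ler_norm.
Qed.

Lemma expect_prod M h :
  expect mu M (fun s => \prod_(w <- s) h w) = (\sum_w mu w * h w) ^+ M.
Proof.
elim: M => [|M IH] /=; first by rewrite big_nil.
rewrite exprS mulr_suml; apply: eq_bigr => w _; rewrite -mulrA; congr (_ * _).
by rewrite -IH -expectZ; apply: eq_expect => s; rewrite big_cons.
Qed.

(** Additivity of the variance; the shift [c] absorbs the coordinate removed by the induction. *)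
Lemma expect_sqr M y v c : \sum_w mu w * y w = 0 -> \sum_w mu w * y w ^+ 2 <= v ->
  expect mu M (fun s => (\sum_(w <- s) y w - c) ^+ 2) <= M%:R * v + c ^+ 2.
Proof.
move=> y0 yv; elim: M c => [|M IH] c /=; first by rewrite big_nil sub0r sqrrN mul0r add0r.
apply: (@le_trans _ _ (\sum_w mu w * (M%:R * v + (c - y w) ^+ 2))).
  apply: ler_sum => w _; apply: ler_wpM2l => //; apply: le_trans (IH _).
  by apply: expect_le => s _; rewrite big_cons le_eqVlt; apply/orP; left; apply/eqP; ring.
have -> : \sum_w mu w * (M%:R * v + (c - y w) ^+ 2) =
    (M%:R * v + c ^+ 2) * (\sum_w mu w) - 2 * c * (\sum_w mu w * y w) +
    \sum_w mu w * y w ^+ 2.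
  rewrite !mulr_sumr -sumrB -big_split /=; apply: eq_bigr => w _; ring.
rewrite mu1 y0 -natr1; lra.
Qed.

End OneMeasure.

(* Lindeberg exchange: replace the i.i.d. coordinates one at a time. *)
Lemma expect_swap (P A h : O -> F) (M : nat) (f : seq O -> F) (de ka ga : F) :
  (forall w, `|A w| <= P w) -> \sum_w P w = 1 -> \sum_w A w = 0 ->
  0 <= ka -> 1 <= ga -> (forall w, 0 <= h w) ->
  \sum_w (P w + A w) * h w <= ga -> \sum_w (P w - A w) * h w <= ga ->
  (forall a s, (size a + size s).+1 = M -> `|\sum_w A w * f (a ++ w :: s)| <=
     de + ka * (\prod_(w <- a) h w * \prod_(w <- s) h w)) ->
  `|expect (fun w => P w + A w) M f - expect (fun w => P w - A w) M f| <=
    2 * M%:R * (de + ka * ga ^+ M).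
Proof.
move=> AP P1 A0 ka0 ga1 h0 ga_p ga_m; elim: M f ka ka0 => [|M IH] f ka ka0 fA.
  by rewrite /= subrr normr0 mulr0 mul0r.
set m1 := fun w => P w + A w; set m2 := fun w => P w - A w.
have m1_ge0 w : 0 <= m1 w by have := AP w; rewrite /m1 ler_norml; lra.
have m2_ge0 w : 0 <= m2 w by have := AP w; rewrite /m2 ler_norml; lra.
have m1_1 : \sum_w m1 w = 1 by rewrite big_split /= P1 A0 addr0.
have m2_1 : \sum_w m2 w = 1 by rewrite sumrB P1 A0 subr0.
(* The first coordinate is kept under [m1] while the rest is exchanged, and is then itself
   exchanged, using [m1 - m2 = 2 A]. *)
have -> : expect m1 M.+1 f - expect m2 M.+1 f =
    \sum_w m1 w * (expect m1 M (fun s => f (w :: s)) - expect m2 M (fun s => f (w :: s)))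
    + 2 * expect m2 M (fun s => \sum_w A w * f (w :: s)).
  rewrite (expect_sum m2 M A (fun w s => f (w :: s))) mulr_sumr -big_split /= -sumrB.
  by apply: eq_bigr => w _; rewrite /m1 /m2; ring.
have h1 : `|\sum_w m1 w * (expect m1 M (fun s => f (w :: s)) -
      expect m2 M (fun s => f (w :: s)))| <= 2 * M%:R * (de + ka * ga ^+ M.+1).
  apply: le_trans (ler_norm_sum _ _ _) _.
  apply: (@le_trans _ _ (\sum_w m1 w * (2 * M%:R * (de + ka * h w * ga ^+ M)))).
    apply: ler_sum => w _; rewrite normrM (ger0_norm (m1_ge0 w)) ler_wpM2l //.
    (* The factor [h w] of the head is absorbed into the constant, which is why [ka] is
       generalized. *)
    apply: IH; first exact: mulr_ge0.
    move=> a s as_M; have := fA (w :: a) s; rewrite /= addSn as_M big_cons => /(_ erefl).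
    by rewrite !mulrA.
  have -> : \sum_w m1 w * (2 * M%:R * (de + ka * h w * ga ^+ M)) =
     2 * M%:R * (de * (\sum_w m1 w) + ka * ga ^+ M * \sum_w m1 w * h w).
    rewrite !mulr_sumr -big_split /= mulr_sumr; apply: eq_bigr => w _; ring.
  rewrite m1_1 mulr1 ler_wpM2l ?mulr_ge0 // lerD2l exprSr mulrA ler_wpM2l //.
  by rewrite mulr_ge0 // exprn_ge0 //; lra.
have h2 : `|expect m2 M (fun s => \sum_w A w * f (w :: s))| <= de + ka * ga ^+ M.+1.
  apply: le_trans (expect_norm m2_ge0 (h := fun s => de + ka * \prod_(w <- s) h w) _) _.
    by move=> s sM; have := fA [::] s; rewrite /= add0n sM big_nil mul1r => /(_ erefl).
  rewrite expectD expectZ expect_cst // expect_prod // lerD2l ler_wpM2l //.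
  apply: (@le_trans _ _ (ga ^+ M)); last by apply: ler_weXn2l.
  by apply: lerXn2r; rewrite ?nnegrE ?sumr_ge0 //; [move=> w _; apply: mulr_ge0 | lra].
apply: le_trans (ler_normD _ _) _; rewrite normrM (ger0_norm (x := 2)) //.
by rewrite -natr1; lra.
Qed.

End IidExpectation.

(** * The two random urns and the test derived from an estimator *)

Section TwoPriors.

(** The successor counts the filler color, present because the other counts sum to less than [k]. *)
Lemma num_colors_coloring k M (x : 'I_M -> nat) (u : {ffun 'I_k -> 'I_M.+1}) :
  u \in colorings 'I_k x -> (\sum_j x j < k)%N ->
  num_colors (fun b => val (u b)) = (\sum_(j < M) (0 < x j)).+1.
Proof.
move=> ux xk; rewrite /num_colors (map_comp val u) (undup_map_inj val_inj) size_map.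
set s := map u _; rewrite -(card_uniqP (undup_uniq s)).
have -> : #|undup s| = (\sum_(c < M.+1) (0 < #|color_class u c|))%N.
  rewrite -sum1_card big_mkcond; apply: eq_bigr => c _; rewrite mem_undup card_gt0.
  have -> : (c \in s) = (color_class u c != set0); last by case: ifP.
  apply/mapP/set0Pn => [[b _ ->]|[b]]; first by exists b; rewrite inE.
  by rewrite inE => /eqP <-; exists b; rewrite // mem_enum.
rewrite big_ord_recl; have := card_filler ux; rewrite card_ord => E.
have -> : (0 < #|color_class u ord0|)%N by lia.
rewrite add1n; congr (_.+1); apply: eq_bigr => j _.
by move: ux; rewrite inE => /forallP/(_ j)/eqP->.
Qed.

Variable F : realFieldType.
Variables (m L : nat) (mu g : F) (O : finType) (P A : O -> F) (N : O -> nat).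
Hypothesis ker : kernel m L mu g P A N.
Hypotheses (m_gt0 : (0 < m)%N) (L_gt0 : (0 < L)%N) (g_gt0 : 0 < g).

Let plus w := P w + A w.
Let minus w := P w - A w.

Lemma kernel_sum0 : \sum_w A w = 0.
Proof.
rewrite -[RHS](kernel_cancel ker L_gt0); apply: eq_bigr => w _.
by rewrite bin0 mulr1.
Qed.

Lemma plus_ge0 w : 0 <= plus w.
Proof. by have := kernel_abs ker w; rewrite /plus ler_norml; lra. Qed.

Lemma minus_ge0 w : 0 <= minus w.
Proof. by have := kernel_abs ker w; rewrite /minus ler_norml; lra. Qed.

Lemma plus_mass : \sum_w plus w = 1.
Proof. by rewrite big_split /= (kernel_mass ker) kernel_sum0 addr0. Qed.

Lemma minus_mass : \sum_w minus w = 1.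
Proof. by rewrite sumrB (kernel_mass ker) kernel_sum0 subr0. Qed.

Lemma kernel_ge0 w : 0 <= P w.
Proof. exact: le_trans (normr_ge0 _) (kernel_abs ker w). Qed.

(* The tail of the total number of colored balls is controlled by the mean of
   [be ^+ N], whose base is small enough that [be ^+ N <= 1 + N / m]. *)
Let be : F := 1 + (2 * m%:R)^-1.
Let ga : F := 1 + 2 * mu / m%:R.

Lemma be_gt1 : 1 < be.
Proof. by rewrite ltrDl invr_gt0 mulr_gt0 // ltr0n. Qed.

Lemma be_pow_le y : (y <= m)%N -> be ^+ y <= 1 + y%:R / m%:R.
Proof.
have m0 : 0 < m%:R :> F by rewrite ltr0n.
elim: y => [|y IH] ym; first by rewrite mul0r addr0.
rewrite exprSr; apply: le_trans (ler_wpM2r _ (IH (ltnW ym))) _.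
  by rewrite ltW // (lt_trans _ be_gt1).
have le : y%:R <= m%:R :> F by rewrite ler_nat ltnW.
rewrite -natr1 /be; set a := m%:R in m0 le *.
have -> : 1 + (y%:R + 1) / a = (1 + y%:R / a) * (1 + (2 * a)^-1)
    + (a - y%:R) / (2 * a ^+ 2) by field; rewrite gt_eqF.
rewrite lerDl divr_ge0 ?subr_ge0 // mulr_ge0 // exprn_ge0 // ltW.
Qed.

Lemma mean_pow_le (nu : O -> F) : (forall w, 0 <= nu w) -> \sum_w nu w = 1 ->
  (forall w, nu w <= 2 * P w) -> \sum_w nu w * be ^+ N w <= ga.
Proof.
move=> nu0 nu1 nuP; have m0 : 0 < m%:R :> F by rewrite ltr0n.
apply: (@le_trans _ _ (\sum_w (nu w + 2 * (P w * (N w)%:R) / m%:R))).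
  apply: ler_sum => w _.
  apply: le_trans (ler_wpM2l (nu0 w) (be_pow_le (kernel_max ker w))) _.
  rewrite mulrDr mulr1 lerD2l !mulrA; apply: ler_wpM2r; first by rewrite invr_ge0 ltW.
  exact: ler_wpM2r.
rewrite big_split /= nu1 lerD2l -mulr_suml -mulr_sumr.
apply: ler_wpM2r; first by rewrite invr_ge0 ltW.
by apply: ler_wpM2l (kernel_mean ker).
Qed.

(** [Q] is the set of equally likely draws, which treats both sampling schemes at once; [B] is the
    cap on the number of colored balls. *)
Variables (k M n Delta B : nat) (est : estimator) (Q : {set n.-tuple 'I_k}).
Hypotheses (M_gt0 : (0 < M)%N) (BmK : (2 * (B + m) <= k)%N)
  (nmk : (32 * n * m <= k * L)%N) (Q_gt0 : (0 < #|Q|)%N).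
Hypothesis estP : forall u : urn k,
  (10 * #|[set t in Q | errs Delta est u t]| <= #|Q|)%N.

Let weight (s : seq O) : nat := (\sum_(w <- s) N w)%N.
Let ncol (s : seq O) : nat := (\sum_(w <- s) (0 < N w)%N)%N.
Let counts (s : seq O) (j : 'I_M) : nat := nth 0%N (map N s) j.

Lemma be_weight s : be ^+ weight s = \prod_(w <- s) be ^+ N w.
Proof. by rewrite -expr_sum. Qed.

Lemma sum_counts s : size s = M -> (\sum_j counts s j = weight s)%N.
Proof.
move=> sM; rewrite /counts /weight -(big_map N xpredT id) (big_nth 0%N) size_map sM.
by rewrite big_mkord.
Qed.

Lemma sum_counts_gt0 s : size s = M -> (\sum_j (0 < counts s j)%N = ncol s)%N.
Proof.
move=> sM; rewrite /counts /ncol -(big_map N xpredT (fun y => nat_of_bool (0 < y)%N)).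
by rewrite (big_nth 0%N) size_map sM big_mkord.
Qed.

Variable th : F.

Let test (t : n.-tuple 'I_k) (u : {ffun 'I_k -> 'I_M.+1}) : F :=
  ((est [seq val (u i) | i <- t])%:~R <= th)%R%:R.

(* Acceptance probability of the test [est <= th], averaged over the draw and
   over all colorings with the given color counts. *)
Let accept (s : seq O) : F :=
  #|Q|%:R^-1 * \sum_(t in Q) coloring_mean (test t) (counts s).

Lemma test_norm t u : `|test t u| <= 1.
Proof. by rewrite normr_nat lern1 leq_b1. Qed.

Lemma accept_norm s : `|accept s| <= 1.
Proof.
have Q0 : 0 < #|Q|%:R :> F by rewrite ltr0n.
rewrite normrM normfV normr_nat ler_pdivrMl // mulr1 -sumr_const.
apply: le_trans (ler_norm_sum _ _ _) _; apply: ler_sum => t _.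
apply: coloring_mean_norm; exact: test_norm.
Qed.

Lemma accept_ge0 s : 0 <= accept s.
Proof.
rewrite mulr_ge0 ?invr_ge0 // sumr_ge0 // => t _.
by rewrite divr_ge0 // sumr_ge0.
Qed.

Lemma accept_exchange s : accept s =
  (\sum_(u in colorings 'I_k (counts s)) (#|Q|%:R^-1 * \sum_(t in Q) test t u))
  / #|colorings 'I_k (counts s)|%:R.
Proof.
rewrite /accept /coloring_mean -mulr_sumr -mulr_suml mulrA; congr (_ * _ / _).
by rewrite exchange_big.
Qed.

Lemma coloring_est_ok (u : {ffun 'I_k -> 'I_M.+1}) :
  #|[set t in Q | errs Delta est (fun b => val (u b)) t]|%:R <= #|Q|%:R / 10 :> F.
Proof.
rewrite ler_pdivlMr // -natrM ler_nat mulnC; exact: estP.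
Qed.

Lemma weight_lt s : (weight s <= B)%N -> (weight s < k)%N.
Proof. by lia. Qed.

(** An estimate without error is below the true number of colors plus [Delta], hence below [th]; so
    the test rejects only on a bad draw. *)
Lemma accept_high s : size s = M -> (weight s <= B)%N ->
  (ncol s).+1%:R + Delta%:R <= th -> 9 / 10 <= accept s.
Proof.
move=> sM sB sth; rewrite accept_exchange.
have sk := weight_lt sB.
have X0 : (0 < #|colorings 'I_k (counts s)|)%N.
  by apply: (@colorings_neq0 F); rewrite sum_counts // card_ord ltnW.
rewrite ler_pdivlMr ?ltr0n // mulr_natr -sumr_const; apply: ler_sum => u uX.
rewrite ler_pdivlMl ?ltr0n //.
have uC := num_colors_coloring uX; rewrite sum_counts // sum_counts_gt0 // in uC.
have := coloring_est_ok u; set bad := [set t in Q | _] => badQ.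
suff : #|Q|%:R - #|bad|%:R <= \sum_(t in Q) test t u by lra.
rewrite lerBlDr -!sum1_card !natr_sum.
rewrite [X in _ <= _ + X](eq_bigl (fun t =>
  (t \in Q) && errs Delta est (fun b => val (u b)) t)); last first.
  by move=> t; rewrite !inE.
rewrite big_mkcondr -big_split /=; apply: ler_sum => t tQ.
case: ifPn => [_|]; first by rewrite lerDr ler0n.
rewrite addr0 /errs uC // -ltnNge => ok.
rewrite /test (_ : (_ <= th) = true) //; apply: le_trans sth.
set e := est _ in ok *.
have : e <= ((ncol s).+1 + Delta)%:Z by lia.
by rewrite -(ler_int F) -natrD.
Qed.

Lemma accept_low s : size s = M -> (weight s <= B)%N ->
  th <= (ncol s).+1%:R - Delta%:R -> accept s <= 1 / 10.
Proof.
move=> sM sB sth; rewrite accept_exchange.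
have sk := weight_lt sB.
have X0 : (0 < #|colorings 'I_k (counts s)|)%N.
  by apply: (@colorings_neq0 F); rewrite sum_counts // card_ord ltnW.
rewrite ler_pdivrMr ?ltr0n // mulr_natr -[leRHS]sumr_const; apply: ler_sum => u uX.
rewrite ler_pdivrMl ?ltr0n //.
have uC := num_colors_coloring uX; rewrite sum_counts // sum_counts_gt0 // in uC.
have := coloring_est_ok u; set bad := [set t in Q | _] => badQ.
suff : \sum_(t in Q) test t u <= #|bad|%:R by lra.
rewrite -sum1_card natr_sum.
rewrite [X in _ <= X](eq_bigl (fun t =>
  (t \in Q) && errs Delta est (fun b => val (u b)) t)); last first.
  by move=> t; rewrite !inE.
rewrite big_mkcondr /=; apply: ler_sum => t tQ.
case: ifPn => [_|]; first by rewrite lern1 leq_b1.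
rewrite /errs uC // -ltnNge => ok.
rewrite /test (_ : (_ <= th) = false) //; apply/negbTE; rewrite -ltNge.
apply: le_lt_trans sth _; set e := est _ in ok *.
have : (ncol s).+1%:Z - Delta%:Z < e by lia.
by rewrite -(ltr_int F) rmorphB.
Qed.

(** If the other colors use at most [B] balls, the cancellation bound holds for every draw.
    Otherwise the trivial bound [1] is dominated by [be] to the excess weight, which is the second
    term. *)
Lemma accept_swap a s : (size a + size s).+1 = M ->
  `|\sum_w A w * accept (a ++ w :: s)| <=
    2 / 2 ^+ L + be ^- B * (\prod_(w <- a) be ^+ N w * \prod_(w <- s) be ^+ N w).
Proof.
move=> asM; rewrite -!be_weight -exprD.
have be0 : 0 < be by rewrite (lt_trans _ be_gt1).
have [asB|asB] := leqP (weight a + weight s) B; last first.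
  apply: (@le_trans _ _ 1).
    rewrite -(kernel_mass ker); apply: le_trans (ler_norm_sum _ _ _) _.
    apply: ler_sum => w _; rewrite normrM -[leRHS]mulr1.
    apply: ler_pM => //; [exact: (kernel_abs ker) | exact: accept_norm].
  have -> : (weight a + weight s = B + (weight a + weight s - B))%N by lia.
  rewrite exprD mulKf ?expf_neq0 ?gt_eqF //.
  apply: ler_wpDl; first by rewrite divr_ge0 // exprn_ge0.
  by rewrite exprn_ege1 // ltW // be_gt1.
apply: (@le_trans _ _ (2 / 2 ^+ L)); last first.
  by rewrite lerDl mulr_ge0 ?invr_ge0 ?exprn_ge0 // ltW.
have aM : (size a < M)%N by rewrite -asM ltnS leq_addr.
pose j := Ordinal aM; pose x (i : 'I_M) := nth 0%N (map N a ++ 0%N :: map N s) i.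
have cE w : counts (a ++ w :: s) =1 update x j (N w).
  move=> i; rewrite /counts /update /x map_cat /= !nth_cat size_map -val_eqE /=.
  case: ltngtP => // [h|->]; last by rewrite subnn.
  by have -> : (i - size a = (i - size a).-1.+1)%N by lia.
have others : (\sum_(i | i != j) x i = weight a + weight s)%N.
  have xj : x j = 0%N by rewrite /x nth_cat size_map ltnn subnn.
  have : (\sum_i x i = weight a + weight s)%N.
    rewrite /x -(big_mkord xpredT (fun i => nth 0%N (map N a ++ 0%N :: map N s) i)).
    have -> : M = size (map N a ++ 0%N :: map N s) by rewrite size_cat /= !size_map addnS.
    by rewrite -(big_nth 0%N xpredT id) big_cat big_cons /= !big_map.
  by rewrite (bigD1 j) //= xj add0n.
have Q0 : 0 < #|Q|%:R :> F by rewrite ltr0n.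
have -> : \sum_w A w * accept (a ++ w :: s) = #|Q|%:R^-1 *
    \sum_(t in Q) \sum_w A w * coloring_mean (test t) (update x j (N w)).
  rewrite exchange_big mulr_sumr; apply: eq_bigr => w _ /=.
  rewrite /accept mulrCA mulr_sumr; congr (_ * _); apply: eq_bigr => t _.
  by rewrite /coloring_mean (colorings_ext 'I_k (cE w)).
rewrite normrM normfV normr_nat ler_pdivrMl // [leRHS]mulr_natl -[leRHS]sumr_const.
apply: le_trans (ler_norm_sum _ _ _) _; apply: ler_sum => t _.
apply: (coloring_mean_cancel ker (D := [set b in t])) => //; rewrite ?others ?card_ord.
- exact: test_norm.
- move=> u u' uu'; rewrite /test.
  have -> // : [seq val (u i) | i <- t] = [seq val (u' i) | i <- t].
  by apply/eq_in_map => b bt; rewrite uu' // inE.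
- by lia.
- by lia.
(* At least [k / 2] balls are left over by the other colors, whence the constant [32] in place of
   [16]. *)
- have tn : (#|[set b in t]| <= n)%N by rewrite cardsE -{2}(size_tuple t) card_size.
  nia.
Qed.

Let qpos (nu : O -> F) := \sum_w nu w * (0 < N w)%N%:R.

(** [A] has total mass zero, so its mass on [N > 0] is the opposite of its mass at [0]. *)
Lemma qpos_gap : 2 * g <= qpos minus - qpos plus.
Proof.
have -> : qpos minus - qpos plus = - (2 * \sum_w A w * (0 < N w)%N%:R).
  rewrite -sumrB mulr_sumr -sumrN; apply: eq_bigr => w _; rewrite /minus /plus; ring.
have := kernel_sum0; rewrite (bigID (fun w => N w == 0%N)) /=.
have -> : \sum_(w | N w != 0%N) A w = \sum_w A w * (0 < N w)%N%:R.
  rewrite big_mkcond; apply: eq_bigr => w _; rewrite lt0n.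
  by case: eqP; rewrite ?mulr0 ?mulr1.
by have := kernel_zero ker; lra.
Qed.

Lemma ncol_variance (nu : O -> F) : (forall w, 0 <= nu w) -> \sum_w nu w = 1 ->
  expect nu M (fun s => ((ncol s)%:R - M%:R * qpos nu) ^+ 2) <= M%:R.
Proof.
move=> nu0 nu1; pose y w : F := (0 < N w)%N%:R - qpos nu.
have q01 : 0 <= qpos nu <= 1.
  apply/andP; split; first by apply: sumr_ge0 => w _; apply: mulr_ge0.
  by rewrite -nu1; apply: ler_sum => w _; rewrite ler_piMr // lern1 leq_b1.
have y0 : \sum_w nu w * y w = 0.
  by under eq_bigr do rewrite mulrBr; rewrite sumrB -mulr_suml nu1 mul1r subrr.
have y1 : \sum_w nu w * y w ^+ 2 <= 1.
  rewrite -[leRHS]nu1; apply: ler_sum => w _; rewrite ler_piMr // -real_normK ?num_real //.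
  rewrite exprn_ile1 // ler_norml /y; case: (0 < N w)%N => /=; lra.
have := expect_sqr nu0 nu1 M 0 y0 y1; rewrite expr0n addr0 mulr1; apply: le_trans.
apply: expect_le => // s sM; rewrite le_eqVlt; apply/orP; left; apply/eqP.
rewrite subr0 sumrB big_const_seq count_predT sM iter_addr_0 -[qpos nu *+ M]mulr_natl.
by rewrite /ncol natr_sum.
Qed.

Hypotheses (M_le : (40 * M <= 2 ^ L)%N) (ga_le : 20 * M%:R * ga ^+ M <= be ^+ B)
  (g_var : 80 <= M%:R * g ^+ 2) (g_gap : 2 * Delta%:R <= M%:R * g).

(** With the threshold midway between the two expected numbers of colors, the test accepts with
    probability at least [8 / 10] under [plus] and at most [2 / 10] under [minus], whereas the
    exchange bound allows a difference of at most [2 / 10]. *)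
Lemma no_test : th <> 1 + M%:R * ((qpos plus + qpos minus) / 2).
Proof.
move=> thE; have [e eE] : {e : F | e = (qpos minus - qpos plus) / 2} by eexists.
have eg : g <= e by have := qpos_gap; rewrite eE; lra.
have e0 : 0 < e := lt_le_trans g_gt0 eg.
have M1 : 1 <= M%:R :> F by rewrite ler1n.
have be0 : 0 < be by rewrite (lt_trans _ be_gt1).
have beB : 0 < be ^- B by rewrite invr_gt0 exprn_gt0.
have mu0 : 0 <= mu.
  apply: le_trans (kernel_mean ker); apply: sumr_ge0 => w _.
  by rewrite mulr_ge0 ?kernel_ge0.
have ga1 : 1 <= ga by rewrite lerDl divr_ge0 ?mulr_ge0.
(* The expected number of colors lies [M e] away from the threshold: half of this is for the
   fluctuations, controlled by Chebyshev with [R], and the other half covers [Delta]. *)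
pose R := (M%:R * e / 2) ^+ 2.
have R0 : 0 < R by rewrite exprn_gt0 // divr_gt0 // mulr_gt0 //; apply: lt_le_trans M1.
have R_var : M%:R / R <= 20^-1.
  rewrite ler_pdivrMr // ler_pdivlMl // /R.
  have eg2 : g ^+ 2 <= e ^+ 2 by apply: lerXn2r => //; rewrite nnegrE ltW.
  have -> : (M%:R * e / 2) ^+ 2 = M%:R * (M%:R * e ^+ 2 / 4) by field.
  have Mg : M%:R * g ^+ 2 <= M%:R * e ^+ 2 by rewrite ler_wpM2l.
  by rewrite [leLHS]mulrC; apply: ler_wpM2l => //; have := g_var; lra.
have plus_le w : plus w <= 2 * P w.
  by have := kernel_abs ker w; rewrite /plus ler_norml; lra.
have minus_le w : minus w <= 2 * P w.
  by have := kernel_abs ker w; rewrite /minus ler_norml; lra.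
pose G (s : seq O) := \prod_(w <- s) be ^+ N w.
have G_ge0 s : 0 <= G s by apply: prodr_ge0 => w _; rewrite exprn_ge0 // ltW.
have G_ge1 s : (B < weight s)%N -> 1 <= be ^- B * G s.
  move=> Bs; rewrite /G -be_weight ler_pdivlMl ?exprn_gt0 // mulr1.
  by apply: ler_weXn2l; [exact: ltW be_gt1 | exact: ltnW].
have G_mean nu : (forall w, 0 <= nu w) -> \sum_w nu w = 1 -> (forall w, nu w <= 2 * P w) ->
    be ^- B * expect nu M G <= (20 * M%:R)^-1.
  move=> nu0 nu1 nuP; rewrite ler_pdivrMl ?exprn_gt0 //.
  rewrite ler_pdivlMr; last by lra.
  apply: le_trans ga_le; rewrite mulrC ler_wpM2l //; first by lra.
  rewrite expect_prod //; apply: lerXn2r; rewrite ?nnegrE.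
  - by apply: sumr_ge0 => w _; rewrite mulr_ge0 // exprn_ge0 // ltW.
  - by lra.
  - exact: mean_pow_le.
have M20 : (20 * M%:R)^-1 <= 20^-1 :> F by rewrite lef_pV2 ?posrE; lra.
have dev_ge1 (z : F) : M%:R * e / 2 <= `|z| -> 1 <= R^-1 * z ^+ 2.
  move=> zl; rewrite ler_pdivlMl // mulr1 /R -[z ^+ 2]real_normK ?num_real //.
  by apply: lerXn2r => //; rewrite nnegrE // divr_ge0 // mulr_ge0 // ltW.
have up : 8 / 10 <= expect plus M accept.
  (* Markov and Chebyshev as one pointwise bound: the [G] term exceeds [1] when the weight is above
     [B], the square term when [ncol] deviates too far. Each costs at most [1 / 20] on average. *)
  apply: (@le_trans _ _ (expect plus M (fun s => 9 / 10 +
      ((- be ^- B) * G s + (- R^-1) * ((ncol s)%:R - M%:R * qpos plus) ^+ 2)))).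
    rewrite expectD expect_cst ?plus_mass // expectD !expectZ.
    have := G_mean plus plus_ge0 plus_mass plus_le.
    have : R^-1 * expect plus M (fun s => ((ncol s)%:R - M%:R * qpos plus) ^+ 2) <= 20^-1.
      apply: le_trans R_var; rewrite [leRHS]mulrC ler_wpM2l ?invr_ge0 ?(ltW R0) //.
      exact: ncol_variance plus_ge0 plus_mass.
    by rewrite !mulNr; lra.
  apply: expect_le => [|s sM]; first exact: plus_ge0.
  have f0 := accept_ge0 s; have g0 : 0 <= be ^- B * G s by rewrite mulr_ge0 // ltW.
  have d0 : 0 <= R^-1 * ((ncol s)%:R - M%:R * qpos plus) ^+ 2.
    by rewrite mulr_ge0 ?sqr_ge0 ?invr_ge0 ?(ltW R0).
  rewrite !mulNr; have [sB|sB] := leqP (weight s) B; last by have := G_ge1 s sB; lra.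
  have [hd|hd] := leP (M%:R * e / 2) `|(ncol s)%:R - M%:R * qpos plus|.
    by have := dev_ge1 _ hd; lra.
  suff : 9 / 10 <= accept s by lra.
  apply: accept_high => //; rewrite -natr1 thE.
  have gl : M%:R * g <= M%:R * e by rewrite ler_wpM2l.
  have := g_gap; move: hd; rewrite ltr_norml.
  have -> : (qpos plus + qpos minus) / 2 = qpos plus + e by rewrite eE; field.
  by rewrite mulrDr; lra.
have down : expect minus M accept <= 2 / 10.
  apply: (@le_trans _ _ (expect minus M (fun s => 1 / 10 +
      (be ^- B * G s + R^-1 * ((ncol s)%:R - M%:R * qpos minus) ^+ 2)))); last first.
    rewrite expectD expect_cst ?minus_mass // expectD !expectZ.
    have := G_mean minus minus_ge0 minus_mass minus_le.
    have : R^-1 * expect minus M (fun s => ((ncol s)%:R - M%:R * qpos minus) ^+ 2) <= 20^-1.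
      apply: le_trans R_var; rewrite [leRHS]mulrC ler_wpM2l ?invr_ge0 ?(ltW R0) //.
      exact: ncol_variance minus_ge0 minus_mass.
    by lra.
  apply: expect_le => [|s sM]; first exact: minus_ge0.
  have f1 : accept s <= 1 := le_trans (ler_norm _) (accept_norm s).
  have g0 : 0 <= be ^- B * G s by rewrite mulr_ge0 // ltW.
  have d0 : 0 <= R^-1 * ((ncol s)%:R - M%:R * qpos minus) ^+ 2.
    by rewrite mulr_ge0 ?sqr_ge0 ?invr_ge0 ?(ltW R0).
  have [sB|sB] := leqP (weight s) B; last by have := G_ge1 s sB; lra.
  have [hd|hd] := leP (M%:R * e / 2) `|(ncol s)%:R - M%:R * qpos minus|.
    by have := dev_ge1 _ hd; lra.
  suff : accept s <= 1 / 10 by lra.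
  apply: accept_low => //; rewrite -natr1 thE.
  have gl : M%:R * g <= M%:R * e by rewrite ler_wpM2l.
  have := g_gap; move: hd; rewrite ltr_norml.
  have -> : (qpos plus + qpos minus) / 2 = qpos minus - e by rewrite eE; field.
  by rewrite mulrBr; lra.
have := expect_swap (kernel_abs ker) (kernel_mass ker) kernel_sum0 (ltW beB) ga1
  (fun w => exprn_ge0 (N w) (ltW be0))
  (mean_pow_le plus_ge0 plus_mass plus_le) (mean_pow_le minus_ge0 minus_mass minus_le)
  accept_swap.
rewrite -/plus -/minus ler_norml => /andP[_].
have h1 : 2 * M%:R * (2 / 2 ^+ L) <= 10^-1 :> F.
  rewrite mulrA ler_pdivrMr ?exprn_gt0 // ler_pdivlMl //.
  by have := M_le; rewrite -(ler_nat F) natrX natrM; lra.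
have h2 : 2 * M%:R * (be ^- B * ga ^+ M) <= 10^-1.
  rewrite mulrCA ler_pdivrMl ?exprn_gt0 //; have := ga_le; lra.
by rewrite mulrDr; lra.
Qed.

End TwoPriors.

Lemma no_estimator (F : realFieldType) (m L : nat) (mu g : F) (O : finType)
    (P A : O -> F) (N : O -> nat) (k M n Delta B : nat) (est : estimator)
    (Q : {set n.-tuple 'I_k}) :
  kernel m L mu g P A N -> (0 < m)%N -> (0 < L)%N -> 0 < g -> (0 < M)%N ->
  (2 * (B + m) <= k)%N -> (32 * n * m <= k * L)%N -> (0 < #|Q|)%N ->
  (40 * M <= 2 ^ L)%N ->
  20 * M%:R * (1 + 2 * mu / m%:R) ^+ M <= (1 + (2 * m%:R)^-1) ^+ B ->
  80 <= M%:R * g ^+ 2 -> 2 * Delta%:R <= M%:R * g ->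
  ~ (forall u : urn k, (10 * #|[set t in Q | errs Delta est u t]| <= #|Q|)%N).
Proof.
move=> ker m0 L0 g0 M0 BmK nmk Q0 ML gaB gv gg estP.
exact: (no_test ker m0 L0 g0 M0 BmK nmk Q0 estP ML gaB gv gg erefl).
Qed.

(** * Choice of the parameters *)

Lemma bernoulli_le (F : realFieldType) (x : F) j : 0 <= x -> 1 + j%:R * x <= (1 + x) ^+ j.
Proof.
move=> x0; elim: j => [|j IH]; first by rewrite mul0r addr0.
rewrite exprS -natr1; apply: (@le_trans _ _ ((1 + x) * (1 + j%:R * x))).
  by have jxx : 0 <= j%:R * x * x :> F; [rewrite !mulr_ge0 | lra].
by rewrite ler_wpM2l //; lra.
Qed.

Lemma infeasible_sample (F : realFieldType) k Delta n T d (est : estimator)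
    (Q : {set n.-tuple 'I_k}) :
  (0 < T)%N -> (0 < d)%N -> (0 < Delta)%N -> (2 ^ (40 * T) * Delta <= k)%N ->
  (k <= 2 ^ (T * d))%N -> (256 * (T * d) ^ 3 <= k)%N -> (256 * n * d <= k)%N ->
  (0 < #|Q|)%N ->
  ~ (forall u : urn k, (10 * #|[set t in Q | errs Delta est u t]| <= #|Q|)%N).
Proof.
move=> T0 d0 D0 kD k_le k_ge nd Q0.
have [O0 [P0 [A0 [N0 ker0]]]] := base_kernel F d0.
have g0 : 0 < 8^-1 :> F by rewrite invr_gt0.
have [O [P [A [N ker]]]] := kernel_pow T (ltW g0) ker0.
set m := (T * (8 * d ^ 2))%N in ker; set L := (T * d.+2)%N in ker.
(* Either law has mean multiplicity at most [20 T], so about [k / 16] balls are colored on average,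
   well below [B]. *)
pose M := (k %/ (320 * T))%N; pose B := (k %/ 4)%N.
have TM : (320 * T * M <= k)%N by rewrite mulnC leq_divM.
have le2T : (T <= 2 ^ T)%N by rewrite ltnW // ltn_expl.
have M_ge y : (y * (320 * T) <= k)%N -> (y <= M)%N.
  by move=> h; rewrite leq_divRL // muln_gt0.
(* This and the next bound are the variance and gap conditions for [g = 8 ^- T]; the exponent [40 T]
   leaves room for the factor [320 T]. *)
have M80 : (80 * 64 ^ T <= M)%N.
  apply: M_ge; apply: leq_trans kD; apply: leq_trans (leq_pmulr _ D0).
  apply: (@leq_trans (2 ^ 15 * (2 ^ T * 64 ^ T))); first by nia.
  rewrite -[64%N]/(2 ^ 6)%N -expnM -!expnD leq_exp2l //; lia.
have M2D : (2 * Delta * 8 ^ T <= M)%N.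
  apply: M_ge; apply: leq_trans kD.
  apply: (@leq_trans (2 ^ 10 * (2 ^ T * 8 ^ T) * Delta)); first by nia.
  by rewrite leq_mul2r -[8%N]/(2 ^ 3)%N -expnM -!expnD leq_exp2l //; lia.
have m4 : (4 * m <= k)%N.
  apply: leq_trans k_ge; rewrite /m expnMn.
  have -> : (4 * (T * (8 * d ^ 2)) = 32 * (T ^ 1 * d ^ 2))%N by ring.
  by apply: leq_mul => //; apply: leq_mul; rewrite leq_pexp2l.
have M0 : (0 < M)%N by apply: leq_trans M80; rewrite muln_gt0 expn_gt0.
have m0 : (0 < m)%N by rewrite muln_gt0 T0 muln_gt0 expn_gt0 d0.
have M_k : (40 * M <= k)%N by apply: leq_trans TM; rewrite leq_mul2r; lia.
have L0 : (0 < L)%N by rewrite muln_gt0 T0.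
have gT : 0 < 8^-1 ^+ T :> F by rewrite exprn_gt0.
have Bm : (2 * (B + m) <= k)%N.
  by rewrite -(leq_pmul2l (ltn0Sn 1)) mulnDr; have := leq_divM k 4; rewrite -/B; lia.
have nm : (32 * n * m <= k * L)%N.
  apply: (@leq_trans (k * (T * d))); last by rewrite !leq_mul2l !leqW ?orbT.
  have -> : (32 * n * m = 256 * n * d * (T * d))%N by rewrite /m; ring.
  by rewrite leq_mul2r nd orbT.
have ML : (40 * M <= 2 ^ L)%N.
  apply: leq_trans M_k _; apply: leq_trans k_le _.
  by rewrite leq_exp2l // leq_mul2l !leqW ?orbT.
apply: (no_estimator ker m0 L0 gT M0 Bm nm Q0 ML).
- set be := 1 + _^-1.
  have mQ : 0 < m%:R :> F by rewrite ltr0n.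
  have inv0 : 0 < (2 * m%:R)^-1 :> F by rewrite invr_gt0 mulr_gt0.
  have be1 : 1 <= be by rewrite lerDl ltW.
  have be0 : 0 <= be := le_trans ler01 be1.
  have be_m : 2 <= be ^+ (2 * m).
    apply: le_trans (bernoulli_le _ (ltW inv0)); rewrite natrM divff //.
    by rewrite mulf_neq0 // gt_eqF.
  (* Everything is compared with powers of [be]: the product of the means costs an exponent of at
     most [k / 8], the factor [20 M] one of at most [k / 16], and the sum fits below [B]. *)
  have ga_be : 1 + 2 * (T%:R * 10) / m%:R <= be ^+ (40 * T).
    apply: le_trans (bernoulli_le _ (ltW inv0)); rewrite lerD2l natrM.
    by rewrite le_eqVlt; apply/orP; left; apply/eqP; field; rewrite gt_eqF.
  have ga_M : (1 + 2 * (T%:R * 10) / m%:R) ^+ M <= be ^+ (40 * T * M).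
    rewrite exprM; apply: lerXn2r => //; rewrite nnegrE.
      by rewrite addr_ge0 // divr_ge0 ?mulr_ge0.
    by rewrite exprn_ge0.
  have tail : 20 * M%:R <= be ^+ (2 * m * (T * d)).
    rewrite exprM; apply: (@le_trans _ _ (2 ^+ (T * d))).
      rewrite -natrX -natrM ler_nat; apply: leq_trans k_le; apply: leq_trans M_k.
      by rewrite leq_mul2r orbT.
    by apply: lerXn2r be_m; rewrite nnegrE // exprn_ge0.
  apply: (@le_trans _ _ (be ^+ (2 * m * (T * d)) * be ^+ (40 * T * M))).
    by apply: ler_pM => //; rewrite ?mulr_ge0 // exprn_ge0 // addr_ge0 // divr_ge0 ?mulr_ge0.
  rewrite -exprD; apply: ler_weXn2l => //.
  have h : (16 * (2 * m * (T * d)) <= k)%N.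
    apply: leq_trans k_ge; rewrite /m expnMn.
    have -> : (16 * (2 * (T * (8 * d ^ 2)) * (T * d)) = 256 * (T ^ 2 * d ^ 3))%N by ring.
    by apply: leq_mul => //; apply: leq_mul; rewrite leq_pexp2l.
  have h' : (8 * (40 * T * M) <= k)%N by rewrite !mulnA.
  rewrite /B leq_divRL //; move: h h'.
  by move: (2 * m * (T * d))%N (40 * T * M)%N; clear; lia.
- rewrite -exprM mulnC exprM; have -> : 8^-1 ^+ 2 = 64^-1 :> F by rewrite exprVn -natrX.
  rewrite exprVn ler_pdivlMr ?exprn_gt0 // -natrX -natrM ler_nat; exact: M80.
- rewrite exprVn ler_pdivlMr ?exprn_gt0 // -natrX -!natrM ler_nat; exact: M2D.
Qed.

Lemma cube_le_exp l : (40 <= l)%N -> (2048 * l ^ 3 <= 2 ^ l)%N.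
Proof.
move=> /subnKC <-; elim: (l - 40)%N => [|e IH].
  rewrite addn0; apply: (@leq_trans (2 ^ 11 * (2 ^ 6) ^ 3)).
    by apply: leq_mul => //; rewrite leq_exp2r.
  by rewrite -expnM -expnD leq_exp2l.
rewrite addnS [leqRHS]expnS; apply: leq_trans (leq_mul (leqnn 2) IH).
rewrite !expnS !expn0; nia.
Qed.

(** Here [l] is the binary logarithm of [k] and [T] is that of [k / Delta] divided by [40], both
    rounded down. With [d = l / T + 1] one has [l < d T <= 2 l], so a smaller [n] would meet the
    conditions of [infeasible_sample]. *)
Lemma sample_size_bound k Delta n (est : estimator) (Q : {set n.-tuple 'I_k}) :
  (0 < Delta)%N -> (2 ^ 40 * Delta <= k)%N -> ((n <= k)%N -> (0 < #|Q|)%N) ->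
  (forall u : urn k, (10 * #|[set t in Q | errs Delta est u t]| <= #|Q|)%N) ->
  exists T l : nat, [/\ (0 < l)%N, (2 ^ l <= k)%N, (k < Delta * 2 ^ (80 * T))%N &
    (k * T <= 512 * n * l)%N].
Proof.
move=> D0 kD Q0 estP.
have k0 : (0 < k)%N by apply: leq_trans kD; rewrite muln_gt0 expn_gt0.
pose q := (k %/ Delta)%N.
have q40 : (2 ^ 40 <= q)%N by rewrite leq_divRL.
have q0 : (0 < q)%N by apply: leq_trans q40; rewrite expn_gt0.
pose la := trunc_log 2 q; pose l := trunc_log 2 k; pose T := (la %/ 40)%N.
have la40 : (40 <= la)%N by apply: trunc_log_max.
have T0 : (0 < T)%N by rewrite divn_gt0.
have laq : (2 ^ la <= q)%N by apply: trunc_logP.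
have qla : (q < 2 ^ la.+1)%N by apply: trunc_log_ltn.
have lk : (2 ^ l <= k)%N by apply: trunc_logP.
have kl : (k < 2 ^ l.+1)%N by apply: trunc_log_ltn.
have la_l : (la <= l)%N by apply: trunc_log_max => //; apply: leq_trans laq (leq_div _ _).
have T_la : (T * 40 <= la)%N by apply: leq_divM.
have la_T : (la < T.+1 * 40)%N by apply: ltn_ceil.
exists T, l; split=> //; first by lia.
  (* As [T >= 1], [la + 1 <= 40 (T + 1) <= 80 T]. *)
  apply: (@leq_trans (Delta * 2 ^ la.+1)); last by rewrite leq_mul2l leq_exp2l //; lia.
  by rewrite mulnC -ltn_divLR.
pose d := (l %/ T).+1.
have dT : (l < d * T)%N by apply: ltn_ceil.
have Td : (T * d <= 2 * l)%N by rewrite /d mulnS; have := leq_divM l T; lia.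
rewrite leqNgt; apply/negP => nlt.
have n_lt : (256 * n * d <= k)%N.
  rewrite -(leq_pmul2r T0); apply: leq_trans (ltnW nlt).
  have -> : (512 * n * l = 256 * n * (2 * l))%N by ring.
  by rewrite -mulnA (mulnC d) leq_mul2l Td orbT.
apply: (@infeasible_sample rat k Delta n T d est Q) => //.
- apply: (@leq_trans (2 ^ la * Delta)); first by rewrite leq_mul2r leq_exp2l //; lia.
  by rewrite -leq_divRL.
- by apply: ltnW; apply: leq_trans kl _; rewrite leq_exp2l // mulnC.
- apply: leq_trans lk; apply: leq_trans (cube_le_exp _); last by lia.
  by rewrite -[2048%N]/(256 * 2 ^ 3)%N -mulnA -expnMn leq_mul2l leq_exp2r.
(* Without replacement there are draws only if [n <= k], which the assumed smallness of [n]
   provides. *)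
- by apply: Q0; apply: leq_trans n_lt; rewrite mulnAC leq_pmull.
Qed.

(* Passage to real logarithms and the final bound *)
From Stdlib Require Import Reals Lra.

Local Close Scope ring_scope.

Lemma leq_INR (a b : nat) : (a <= b)%N -> (INR a <= INR b)%R.
Proof. by move=> ab; apply: le_INR; apply/ssrnat.leP. Qed.

Lemma INR_exp2 (a : nat) : INR (expn 2 a) = (2 ^ a)%R.
Proof. by elim: a => // a IH; rewrite expnS mult_INR IH. Qed.

Lemma Nat_powE (a b : nat) : Nat.pow a b = expn a b.
Proof. by elim: b => //= b ->; rewrite expnS. Qed.

Lemma ln_le_mono (x y : R) : (0 < x)%R -> (x <= y)%R -> (ln x <= ln y)%R.
Proof.
move=> x0 [xy|->]; last exact: Rle_refl.
by apply: Rlt_le; apply: ln_increasing.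
Qed.

(** Chain [ln (k / Delta) <= 80 T ln 2], [k T <= 512 n l] and [l ln 2 <= ln k]; the constant is
    [80 * 512 = 40960]. *)
Lemma bound_of_nat_bound (k Delta n T l : nat) : (0 < Delta)%N -> (0 < l)%N ->
  (expn 2 l <= k)%N -> (k < Delta * expn 2 (80 * T))%N -> (k * T <= 512 * n * l)%N ->
  (/ 40960 * (INR k / ln (INR k)) * ln (INR k / INR Delta) <= INR n)%R.
Proof.
move=> D0 l0 lk kD kT.
have D0' : (0 < INR Delta)%R by apply: lt_0_INR; apply/ssrnat.ltP.
have l0' : (0 < INR l)%R by apply: lt_0_INR; apply/ssrnat.ltP.
have p2 a : (0 < 2 ^ a)%R by apply: pow_lt; Lra.lra.
have ln2 : (0 < ln 2)%R by rewrite -ln_1; apply: ln_increasing; Lra.lra.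
have lk' : (2 ^ l <= INR k)%R by rewrite -INR_exp2; apply: leq_INR.
have k0 : (0 < INR k)%R by apply: Rlt_le_trans lk'.
have lnk : (INR l * ln 2 <= ln (INR k))%R by rewrite -ln_pow; [apply: ln_le_mono | Lra.lra].
have lnk0 : (0 < INR l * ln 2)%R by apply: Rmult_lt_0_compat.
have q0 : (0 < INR k / INR Delta)%R by apply: Rdiv_lt_0_compat.
have lnq : (ln (INR k / INR Delta) <= INR 80 * INR T * ln 2)%R.
  rewrite -mult_INR -ln_pow; last by Lra.lra.
  apply: ln_le_mono => //; apply: (Rmult_le_reg_r (INR Delta)) => //.
  have -> : (INR k / INR Delta * INR Delta = INR k)%R by field; Lra.lra.
  by rewrite Rmult_comm -INR_exp2 -mult_INR; apply: leq_INR; apply: ltnW.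
have kT' : (INR k * INR T <= 512 * INR n * INR l)%R.
  have := leq_INR kT; rewrite !mult_INR; have -> : INR 512 = 512%R by rewrite INR_IZR_INZ.
  by [].
have n0 : (0 <= INR n)%R by apply: pos_INR.
have i80 : INR 80 = 80%R by rewrite INR_IZR_INZ.
rewrite i80 in lnq.
apply: (Rmult_le_reg_r (ln (INR k))); first by Lra.lra.
have -> : (/ 40960 * (INR k / ln (INR k)) * ln (INR k / INR Delta) * ln (INR k) =
  / 40960 * (INR k * ln (INR k / INR Delta)))%R by field; Lra.lra.
apply: (Rle_trans _ (INR n * (INR l * ln 2))); last first.
  by apply: Rmult_le_compat_l.
have h1 : (INR k * ln (INR k / INR Delta) <= INR k * (80 * INR T * ln 2))%R.
  by apply: Rmult_le_compat_l => //; Lra.lra.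
have h2 : (INR k * INR T * ln 2 <= 512 * INR n * INR l * ln 2)%R.
  by apply: Rmult_le_compat_r => //; Lra.lra.
by Lra.lra.
Qed.

(* n^*(k,Delta) >= B  <=>  every feasible sample size n satisfies n >= B. *)
Theorem theorem4 :
  exists c c' : R, (0 < c)%R /\ (0 < c')%R /\
    forall k Delta : nat, (2 <= k)%N -> (1 <= Delta)%N ->
      (INR Delta <= c * INR k)%R ->
      forall n : nat,
        (feasible_wr k Delta n ->
           (c' * (INR k / ln (INR k)) * ln (INR k / INR Delta) <= INR n)%R) /\
        (feasible_wor k Delta n ->
           (c' * (INR k / ln (INR k)) * ln (INR k / INR Delta) <= INR n)%R).
Proof.
have c0 : (0 < 2 ^ 40)%R by apply: pow_lt; Lra.lra.
(* The value of [c] makes [k / Delta] at least [2 ^ 40], so that the convolution exponent [T] is at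
   least [1]. *)
exists (/ 2 ^ 40)%R, (/ 40960)%R; split; first exact: Rinv_0_lt_compat.
split; first by Lra.lra.
move=> k Delta _ D0 Dk n.
have kD : (expn 2 40 * Delta <= k)%N.
  apply/ssrnat.leP/INR_le; rewrite mult_INR INR_exp2.
  have := Rmult_le_compat_l _ _ _ (Rlt_le _ _ c0) Dk.
  by rewrite -Rmult_assoc Rinv_r ?Rmult_1_l //; Lra.lra.
have bound (est : estimator) (Q : {set n.-tuple 'I_k}) : ((n <= k)%N -> (0 < #|Q|)%N) ->
    (forall u : urn k, (10 * #|[set t in Q | errs Delta est u t]| <= #|Q|)%N) ->
    (/ 40960 * (INR k / ln (INR k)) * ln (INR k / INR Delta) <= INR n)%R.
  move=> Q0 /(sample_size_bound D0 kD Q0)[T [l [l0 lk kT nT]]].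
  exact: bound_of_nat_bound lk kT nT.
split=> -[est estP].
- apply: (bound est [set: n.-tuple 'I_k]) => [nk|u].
    rewrite cardsT card_tuple card_ord expn_gt0.
    by have [k0|] := posnP k => //=; move: nk; rewrite k0 leqn0.
  rewrite cardsT card_tuple card_ord -Nat_powE; apply: leq_trans (estP u).
  by rewrite leq_mul2l subset_leq_card // subsetE; apply/pred0P => t; rewrite !inE andNb.
- apply: (bound est [set t : n.-tuple 'I_k | uniq t]) => [nk|u].
    have := card_uniq_tuples n (@predT 'I_k); rewrite card_ord => E.
    rewrite -ffact_gt0 -E in nk; move: nk; congr (is_true (0 < _)%N).
    by apply: eq_card => t; rewrite !inE all_predT.
  apply: leq_trans (estP u).
  by rewrite leq_mul2l subset_leq_card // subsetE; apply/pred0P => t; rewrite !inE andNb.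
Qed.
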